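(* Fix a price vector $p\in\mathbb R_+^M$, let $X^*$ be the unique minimal maximizer of the over-demand function $\mathcal O(\cdot;p)$, and let $z^*$ be the unique minimal solution of the problem $(D_2)$ at $p$ defined in the context. Then the restriction $z^*|_{X^*}$ is the unique minimal solution of $$\min_{z'\in\mathbb R_\gamma^{X^*},\ z'\ge\mathbf 0}\ \left\{\sum_{i\in N}\max_{y_i\in[\mathbf 0,s]_{\mathbb Z}^{X^*}}\Bigl(\tilde v_i(y_i)-\sum_{j\in X^*}z'_jy_{ij}\Bigr)+\sum_{j\in X^*}s_jz'_j\right\},$$ where $\tilde v_i$ is the virtual valuation defined in the context.
   Context: **Market model.** $M=\{1,\dots,m\}$ is the set of goods, $N=\{1,\dots,n\}$ with $n\ge 2$ the set of buyers, $s\in\mathbb Z_+^M$ the supply vector, and $[\mathbf 0,s]_{\mathbb Z}=\{x\in\mathbb Z_+^M : x\le s\}$ (vector inequalities are componentwise). For $x\in\mathbb R^M$ and $X\subseteq M$ put $x(X)=\sum_{j\in X}x_j$; $\chi_j$ is the $j$-th unit vector, $\chi_0=\mathbf 0$; $\operatorname{supp}_+(x)=\{j:x_j>0\}$, $\operatorname{supp}_-(x)=\{j:x_j<0\}$. Each buyer $i$ has a valuation $v_i:[\mathbf 0,s]_{\mathbb Z}\to\mathbb R_+$ with $v_i(\mathbf 0)=0$, monotone ($x\le y\Rightarrow v_i(x)\le v_i(y)$), and $\mathrm M^\natural$-concave: for all $x,x'\in[\mathbf 0,s]_{\mathbb Z}$ and $j\in\operatorname{supp}_+(x-x')$ there is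 $k\in\operatorname{supp}_-(x-x')\cup\{0\}$ with $v_i(x)+v_i(x')\le v_i(x-\chi_j+\chi_k)+v_i(x'+\chi_j-\chi_k)$ (with $v_i=-\infty$ outside $[\mathbf 0,s]_{\mathbb Z}$). For each $(i,j)\in N\times M$ there is a payment function $q_{ij}:\mathbb R_+\to\mathbb R_+$ that is continuous, piecewise-linear (specified by finitely many breakpoints and slopes), strictly increasing, with $q_{ij}(0)=0$, and such that $q_{ij}(\kappa)=v_i(\chi_j)$ for some $\kappa\in\mathbb R_+$; $q'_{ij}$ denotes its right derivative. For a price vector $p\in\mathbb R_+^M$, $u_i(x;p)=v_i(x)-\sum_{j\in M}q_{ij}(p_j)x_j$, $D_i(p)=\arg\max_{x\in[\mathbf 0,s]_{\mathbb Z}}u_i(x;p)$, and $\check D_i(p)$ is the set of (componentwise) minimal elements of $D_i(p)$. **Over-demand.** $\mu_i(X;p)=\min\{x(X):x\in D_i(p)\}$ and $\mathcal O(X;p)=\sum_{i\in N}\mu_i(X;p)-s(X)$ for $X\subseteq M$. The function $\mathcal O(\cdot;p)$ is supermodular, so it has a unique inclusion-minimal maximizer. **Lexicographic dual problem $(D_2)$.** Let $\check\rho_i(X;p)=\max\{x(X):x\in\check D_i(p)\}$ and $P(\check\rho_i)=\{x\in\mathbb Z_+^M: x(S)\le\check\rho_i(S;p)\ \forall S\subseteq M\}$. Let $\gamma$ be a symbolic ''sufficiently small'' positive constant: let $\mathbb R_\gamma=\{a+\gamma b: a,b\in\mathbb R\}$ (identified with pairs $(a,b)$), with addition componentwise in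 $(a,b)$ and with the lexicographic order ($a_1+\gamma b_1>a_2+\gamma b_2$ iff $a_1>a_2$, or $a_1=a_2$ and $b_1>b_2$); vectors over $\mathbb R_\gamma$ are compared componentwise. Put $w_{ij}=1-\gamma\log q'_{ij}(p_j)$. Problem $(D_2)$ is to minimize, over $z\in\mathbb R_\gamma^M$ with $z\ge\mathbf 0$, $\mathcal L(z)=\sum_{i\in N}\max_{x_i\in P(\check\rho_i)}\sum_{j\in M}(w_{ij}-z_j)x_{ij}+\sum_{j\in M}s_jz_j$. It is known that $(D_2)$ has a unique minimal optimal solution. **Virtual market on $X^*$.** For $S\subseteq X^*$ let $\tilde\rho_i(S)=\check\rho_i(S\cup(M\setminus X^* );p)-\check\rho_i(M\setminus X^*;p)$, and $P(\tilde\rho_i)=\{y\in\mathbb Z_+^{X^*}: y(S)\le\tilde\rho_i(S)\ \forall S\subseteq X^*\}$. Let $[\mathbf 0,s]_{\mathbb Z}^{X^*}=\{y\in\mathbb Z_+^{X^*}:0\le y_j\le s_j\ \forall j\in X^*\}$. The virtual valuation of buyer $i$ on $[\mathbf 0,s]_{\mathbb Z}^{X^*}$ is $\tilde v_i(y_i)=\sum_{j\in X^*}w_{ij}y_{ij}$ if $y_i\in P(\tilde\rho_i)$, and $\tilde v_i(y_i)=-\infty$ otherwise. *)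

(* Defs.v *)
From HB Require Import structures.
From mathcomp Require Import all_boot all_order all_algebra.
From mathcomp Require Import all_classical reals topology normedtype exp.

Set Implicit Arguments.
Unset Strict Implicit.
Unset Printing Implicit Defensive.

Import Order.TTheory GRing.Theory Num.Theory.
Import numFieldNormedType.Exports.

Local Open Scope classical_set_scope.
Local Open Scope ring_scope.

Definition set_max d (T : porderType d) (x0 : T) (A : set T) : T :=
  xget x0 (A `&` ubound A).

Definition set_min d (T : porderType d) (x0 : T) (A : set T) : T :=
  xget x0 (A `&` lbound A).

Definition minimals T (le : T -> T -> Prop) (A : set T) : set T :=
  [set a | A a /\ forall b, A b -> le b a -> b = a].

Definition is_unique_minimal T (le : T -> T -> Prop) (A : set T) (a : T) : Prop :=
  minimals le A = [set a].

Definition minimizers d (V : porderType d) T (F : set T) (f : T -> V) : set T :=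
  [set z | F z /\ forall z', F z' -> (f z <= f z')%O].

Definition maximizers d (V : porderType d) T (F : set T) (f : T -> V) : set T :=
  [set z | F z /\ forall z', F z' -> (f z' <= f z)%O].

(** R_gamma: the pair [(a, b)] stands for [a + gamma b]. *)
Definition gammaR (R : realType) : Type := (R * R)%type.
HB.instance Definition _ (R : realType) := GRing.Zmodule.copy (gammaR R) (R * R)%type.
HB.instance Definition _ (R : realType) := Order.Total.copy (gammaR R) (R *l R).

(** R_gamma with -oo adjoined; [None] is -oo and absorbs addition. *)
Definition gammaRN (R : realType) : Type := option (gammaR R).
HB.instance Definition _ (R : realType) := Choice.on (gammaRN R).

Section GammaRN.
Variable R : realType.
Implicit Types x y z : gammaRN R.

Definition gammaRN_add x y : gammaRN R :=
  if x is Some a then if y is Some b then Some (a + b) else None else None.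

Definition gammaRN_le x y : bool :=
  if x is Some a then if y is Some b then (a <= b)%O else false else true.

Fact gammaRN_addA : associative gammaRN_add.
Proof. by move=> [x|] [y|] [z|] //=; rewrite addrA. Qed.

Fact gammaRN_addC : commutative gammaRN_add.
Proof. by move=> [x|] [y|] //=; rewrite addrC. Qed.

Fact gammaRN_add0 : left_id (Some 0) gammaRN_add.
Proof. by move=> [x|] //=; rewrite add0r. Qed.

HB.instance Definition _ := GRing.isNmodule.Build (gammaRN R)
  gammaRN_addA gammaRN_addC gammaRN_add0.

Fact gammaRN_display : Order.disp_t.
Proof. exact: Order.Disp tt tt. Qed.

Fact gammaRN_lexx : reflexive gammaRN_le.
Proof. by move=> [x|] //=. Qed.

Fact gammaRN_le_anti : antisymmetric gammaRN_le.
Proof. by move=> [x|] [y|] //= /le_anti ->. Qed.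

Fact gammaRN_le_trans : transitive gammaRN_le.
Proof. by move=> [x|] [y|] [z|] //=; exact: le_trans. Qed.

HB.instance Definition _ := Order.Le_isPOrder.Build gammaRN_display (gammaRN R)
  gammaRN_lexx gammaRN_le_anti gammaRN_le_trans.

End GammaRN.

Section Bundles.
Variable G : finType.
Implicit Types (x y s : {ffun G -> nat}) (X S : {set G}).

Definition bundle_le x y : Prop := forall j, (x j <= y j)%N.

Definition box s : set {ffun G -> nat} := [set x | bundle_le x s].

Definition bsum x X : nat := (\sum_(j in X) x j)%N.

(** [chi (Some j)] is the unit vector of [j] and [chi None] the zero vector. *)
Definition chi (k : option G) : {ffun G -> nat} := [ffun l => (Some l == k : nat)].

(** x - chi_j + chi_k; the truncated subtraction is exact as soon as
    [(chi j l <= x l)%N] for all [l]. *)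
Definition exchange x (j k : option G) : {ffun G -> nat} :=
  [ffun l => (x l + chi k l - chi j l)%N].

Definition polymatroid (rho : {set G} -> int) : set {ffun G -> nat} :=
  [set x | forall S, (bsum x S)%:Z <= rho S].

Definition gvec_le (R : realType) (z z' : {ffun G -> gammaR R}) : Prop :=
  forall j, (z j <= z' j)%O.

Definition gvec_nneg (R : realType) : set {ffun G -> gammaR R} :=
  [set z | gvec_le 0 z].

End Bundles.

Section Market.
Variables (R : realType) (m : nat).
Implicit Types (s x y : {ffun 'I_m -> nat}) (v : {ffun 'I_m -> nat} -> R).

(** For [x], [x'] in the box and [j], [k] as below, both exchanged vectors are
    nonnegative and lie in the box again, so the value -oo of the valuation
    outside the box never occurs and no subtraction is truncated. *)
Definition Mnat_concave s v : Prop :=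
  forall x x', box s x -> box s x' -> forall j : 'I_m, (x' j < x j)%N ->
  exists k : option 'I_m,
    (if k is Some k' then (x k' < x' k')%N else True) /\
    v x + v x' <= v (exchange x (Some j) k) + v (exchange x' k (Some j)).

(** Only the values of [v] on [box s] are meaningful. *)
Record is_valuation s v : Prop := {
  valuation_ge0 : forall x, box s x -> 0 <= v x ;
  valuation0 : v 0 = 0 ;
  valuation_mono : forall x y, box s x -> box s y -> bundle_le x y -> v x <= v y ;
  valuation_Mnat : Mnat_concave s v }.

(** [b] lists the positive breakpoints and [c] the slopes: [f] has slope
    [c_l] on the [l]-th piece, which starts at [(0 :: b)_l] and ends before
    [b_l] (at infinity if [l = size b]). *)
Definition piecewise_linear (f : R -> R) : Prop :=
  exists b c : seq R,
    [/\ sorted <%R (0 :: b), size c = (size b).+1 &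
      forall (l : nat) (x y : R), (l <= size b)%N ->
        (0 :: b)`_l <= x -> x <= y -> ((l < size b)%N -> y < b`_l) ->
        f y - f x = c`_l * (y - x)].

(** Only the values on the nonnegative half-line are meaningful. *)
Record is_payment (f : R -> R) : Prop := {
  payment_ge0 : forall a, 0 <= a -> 0 <= f a ;
  payment_continuous : {within `[0, +oo[, continuous f} ;
  payment_piecewise_linear : piecewise_linear f ;
  payment_increasing : forall a b, 0 <= a -> a < b -> f a < f b ;
  payment0 : f 0 = 0 }.

(** [v (chi_j)] is defined only if the supply of [j] is positive. *)
Definition payment_reaches s v (f : 'I_m -> R -> R) : Prop :=
  forall j, box s (chi (Some j)) ->
  exists2 kappa, 0 <= kappa & f j kappa = v (chi (Some j)).

Definition right_derive (f : R -> R) (x : R) : R :=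
  lim (h^-1 * (f (x + h) - f x) @[h --> 0^'+]).

End Market.

Section Auction.
Variables (R : realType) (m n : nat) (s : {ffun 'I_m -> nat}).
Variables (v : 'I_n -> {ffun 'I_m -> nat} -> R) (q : 'I_n -> 'I_m -> R -> R).
Variable p : 'I_m -> R.
Implicit Types (i : 'I_n) (X : {set 'I_m}).

Definition utility i (x : {ffun 'I_m -> nat}) : R :=
  v i x - \sum_j q i j (p j) *+ x j.

Definition demand i : set {ffun 'I_m -> nat} := maximizers (box s) (utility i).

Definition min_demand i : set {ffun 'I_m -> nat} :=
  minimals (@bundle_le _) (demand i).

Definition mu i X : nat := set_min 0%N [set bsum x X | x in demand i].

Definition overdemand X : int := (\sum_i mu i X)%:Z - (bsum s X)%:Z.

Definition crho i X : nat := set_max 0%N [set bsum x X | x in min_demand i].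

(** 1 - gamma log q'_ij(p_j). *)
Definition weight i (j : 'I_m) : gammaR R :=
  (1, - ln (right_derive (q i j) (p j))).

Definition D2_obj (z : {ffun 'I_m -> gammaR R}) : gammaR R :=
  \sum_i set_max (0 : gammaR R) [set \sum_j (weight i j - z j) *+ x j
                   | x in polymatroid (fun X => (crho i X)%:Z)]
  + \sum_j z j *+ s j.

Definition D2_solutions : set {ffun 'I_m -> gammaR R} :=
  minimizers (@gvec_nneg _ R) D2_obj.

Section Virtual.
Variable X : {set 'I_m}.
Let XG := {j : 'I_m | j \in X}.

Definition srestr T (f : {ffun 'I_m -> T}) : {ffun XG -> T} :=
  [ffun j => f (val j)].

Definition trho i (S : {set XG}) : int :=
  (crho i ([set val j | j in S] :|: ~: X))%:Z - (crho i (~: X))%:Z.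

Definition vvaluation i (y : {ffun XG -> nat}) : gammaRN R :=
  if y \in polymatroid (trho i) then Some (\sum_j weight i (val j) *+ y j)
  else None.

Definition virtual_obj (z : {ffun XG -> gammaR R}) : gammaRN R :=
  \sum_i set_max (None : gammaRN R)
           [set vvaluation i y + (Some (- \sum_j z j *+ y j) : gammaRN R)
           | y in box (srestr s)]
  + (Some (\sum_j z j *+ srestr s j) : gammaRN R).

Definition virtual_solutions : set {ffun XG -> gammaR R} :=
  minimizers (@gvec_nneg _ R) virtual_obj.

End Virtual.
End Auction.

(* Main.v *)
(** Only the minimal demand sets [B_i] matter. They are M-convex, so linear
    weights are maximized over the polymatroid [P(rho_i)] by vectors that are
    tight on all superlevel sets of the weight (greedy), and the maximum is a
    layer-cake sum of values of [rho_i]. Consequences: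
    - [O(S)] is, up to a constant, minus the leading term of the objective at
      the indicator of [S]; hence at a solution [z] of (D_2) the goods with
      leading price at least 1 form a maximizer of [O], which contains [X = X*].
    - By minimality of [z], the leading price is exactly 1 on [X] and less than
      1 off [X]. (The prices off [X] need not vanish.)
    - For such prices every buyer saturates the complement of [X] first, so the
      objective splits into a part independent of the prices on [X] plus the
      objective of the virtual market.
    - Prices [y] on [X] that violate the gap are moved close to [z] by a convex
      combination, which makes the splitting applicable.
    - The objective is submodular in the prices, so [z] lies below every
      solution of (D_2); the same convex combination transfers this to the
      virtual market. *)

Require Import Defs.
From mathcomp Require Import all_boot all_order all_algebra.
From mathcomp Require Import all_classical reals topology normedtype exp.
From mathcomp Require Import zify lra.

Set Implicit Arguments.
Unset Strict Implicit.
Unset Printing Implicit Defensive.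

Import Order.TTheory GRing.Theory Num.Theory.
Local Open Scope classical_set_scope.
Local Open Scope ring_scope.

(** * Extrema of sets *)

Lemma set_max_eq d (T : porderType d) (x0 : T) (A : set T) a :
  A a -> ubound A a -> set_max x0 A = a.
Proof.
move=> Aa ubA; apply: xget_subset1; first by split.
by move=> x y [Ax ubx] [Ay uby]; apply/le_anti/andP; split; [apply: uby|apply: ubx].
Qed.

Lemma set_min_eq d (T : porderType d) (x0 : T) (A : set T) a :
  A a -> lbound A a -> set_min x0 A = a.
Proof.
move=> Aa lbA; apply: xget_subset1; first by split.
by move=> x y [Ax lbx] [Ay lby]; apply/le_anti/andP; split; [apply: lbx|apply: lby].
Qed.

(** * Bundles, exchanges and M-convex sets *)

Section Bundles.
Variable G : finType.
Implicit Types (x y b : {ffun G -> nat}) (A B : set {ffun G -> nat}).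

Lemma ex_maximizer d (V : orderType d) b A (f : {ffun G -> nat} -> V) :
  A `<=` box b -> A !=set0 ->
  exists2 x, A x & forall y, A y -> (f y <= f x)%O.
Proof.
move=> Ab [x0 Ax0].
(* [N] bounds every [b j], so the finite type [{ffun G -> 'I_N.+1}] covers [A]. *)
pose N := (\sum_j b j)%N.
pose phi (g : {ffun G -> 'I_N.+1}) : {ffun G -> nat} := [ffun j => val (g j)].
have phi_onto x : A x -> exists g, phi g = x.
  move=> Ax; exists [ffun j => inord (x j)]; apply/ffunP => j; rewrite !ffunE /=.
  rewrite inordK // ltnS; apply: leq_trans (Ab _ Ax j) _.
  by rewrite /N (bigD1 j) //= leq_addr.
have [g0 g0E] := phi_onto _ Ax0.
have g0P : `[< A (phi g0) >] by apply/asboolP; rewrite g0E.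
case: (@Order.TotalTheory.arg_maxP _ _ _ g0 (fun g => `[< A (phi g) >]) (fun g => f (phi g)) g0P) => g /asboolP Ag gmax.
exists (phi g) => // y Ay; have [h hE] := phi_onto _ Ay.
by rewrite -hE; apply: gmax; apply/asboolP; rewrite hE.
Qed.

Definition wsum (r : G -> nat) x : nat := (\sum_j r j * x j)%N.

Lemma bsum_wsum x (S : {set G}) : bsum x S = wsum (fun j => (j \in S : nat)) x.
Proof.
rewrite /bsum /wsum big_mkcond; apply: eq_bigr => j _.
by case: (j \in S); rewrite ?mul1n ?mul0n.
Qed.

Lemma bsumT x : bsum x [set: G] = (\sum_j x j)%N.
Proof. by apply: eq_bigl => j; rewrite inE. Qed.

Lemma bsum_compl x (S : {set G}) : (bsum x S + bsum x (~: S) = bsum x [set: G])%N.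
Proof.
rewrite bsumT (bigID (mem S)) /=; congr addn.
by apply: eq_bigl => j; rewrite inE.
Qed.

Lemma bsumUI x (S S' : {set G}) :
  (bsum x (S :|: S')%SET + bsum x (S :&: S')%SET = bsum x S + bsum x S')%N.
Proof.
rewrite !bsum_wsum /wsum -!big_split /=; apply: eq_bigr => j _.
by rewrite -!mulnDl !inE; case: (j \in S); case: (j \in S').
Qed.

Lemma bsumS x (S S' : {set G}) : S \subset S' -> (bsum x S <= bsum x S')%N.
Proof.
move=> /fintype.subsetP SS'; rewrite !bsum_wsum; apply: leq_sum => j _.
by rewrite leq_mul2r; case: (boolP (j \in S)) => [/SS' ->|]; rewrite ?orbT.
Qed.

Lemma bsum_le x y (S : {set G}) : bundle_le x y -> (bsum x S <= bsum y S)%N.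
Proof. by move=> xy; apply: leq_sum. Qed.

Lemma bsum1 x j : bsum x [set j] = x j.
Proof. by rewrite /bsum big_set1. Qed.

Lemma chi_Some (k l : G) : chi (Some k) l = (l == k).
Proof. by rewrite ffunE. Qed.

Lemma chi_None (l : G) : chi None l = 0%N.
Proof. by rewrite ffunE. Qed.

Lemma wsum_exchange r x j l : (0 < x j)%N ->
  (wsum r (exchange x (Some j) (Some l)) + r j = wsum r x + r l)%N.
Proof.
move=> xj.
have rE k : r k = (\sum_j r j * (j == k))%N.
  rewrite (bigD1 k) //= eqxx muln1 big1 ?addn0 // => i /negPf ->.
  by rewrite muln0.
rewrite [in LHS](rE j) [in RHS](rE l) /wsum -!big_split /=.
apply: eq_bigr => k _; rewrite -!mulnDr ffunE !chi_Some; congr (_ * _)%N.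
by case: (k =P j) => [->|_]; lia.
Qed.

Lemma bsum_exchange x j l (S : {set G}) : (0 < x j)%N ->
  (bsum (exchange x (Some j) (Some l)) S + (j \in S) = bsum x S + (l \in S))%N.
Proof. by move=> xj; rewrite !bsum_wsum (wsum_exchange (fun j => (j \in S : nat))). Qed.

(** The unit taken from [j] creates no deficit, because [y j] exceeds [x j]. This is the decreasing
    measure of the inductions that move [y] towards [x]. *)
Lemma excess_exchange x y j l : (x j < y j)%N -> (y l < x l)%N ->
  (\sum_k (x k - exchange y (Some j) (Some l) k) < \sum_k (x k - y k))%N.
Proof.
move=> yj yl; rewrite (bigD1 l) //= [ltnRHS](bigD1 l) //=.
rewrite -addSn leq_add //.
  rewrite !ffunE eqxx.
  have -> : (Some l == Some j) = false.
    by apply/eqP => -[lj]; move: yj yl; rewrite lj; lia.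
  lia.
apply: leq_sum => k /negPf kl; rewrite !ffunE.
have -> : (Some k == Some l) = false by [].
by case: (Some k =P Some j) => [[->]|_]; lia.
Qed.

(** In contrast to the M-natural exchange, the partner [l] is always a good and never the zero
    vector, which fixes the total of the members. *)
Definition Mconvex B : Prop := forall x y j, B x -> B y -> (y j < x j)%N ->
  exists l, [/\ (x l < y l)%N, B (exchange x (Some j) (Some l)) &
    B (exchange y (Some l) (Some j))].

(* If [y] beats [x] on [S], then an exchange moving [y] towards [x] keeps
   [y(S)]: the good that [y] receives is in [S] because [x] maximizes [r]. *)
Lemma Mconvex_greedy B r x : Mconvex B -> B x ->
  (forall y, B y -> (wsum r y <= wsum r x)%N) ->
  forall S : {set G}, (forall j l, j \in S -> (r j <= r l)%N -> l \in S) ->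
  forall y, B y -> (bsum y S <= bsum x S)%N.
Proof.
move=> MB Bx xmax S Sup y.
have [N] := ubnP (\sum_k (x k - y k))%N; elim: N y => // N IH y; rewrite ltnS => yN By.
rewrite leqNgt; apply/negP => Slt.
have [j jS yj] : exists2 j, j \in S & (x j < y j)%N.
  apply/exists_inP; apply: contraTT Slt => /exists_inPn H.
  by rewrite -leqNgt; apply: leq_sum => j /H; rewrite -leqNgt.
have [l [yl By' Bx']] := MB _ _ _ By Bx yj.
have lS : l \in S.
  apply: (Sup j) => //.
  rewrite -(leq_add2l (wsum r x)) -(wsum_exchange r j (leq_ltn_trans (leq0n _) yl)).
  by rewrite leq_add2r xmax.
have := IH _ (leq_trans (excess_exchange yj yl) yN) By'.
have := bsum_exchange l S (leq_ltn_trans (leq0n _) yj).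
by rewrite jS lS => /addIn ->; rewrite leqNgt Slt.
Qed.

(** * The rank function of an M-convex set *)

Section RankFunction.
Variables (B : set {ffun G -> nat}) (b : {ffun G -> nat}) (rho : {set G} -> nat).
Hypotheses (MB : Mconvex B) (Bb : B `<=` box b) (B0 : B !=set0).
Hypothesis rho_ub : forall x S, B x -> (bsum x S <= rho S)%N.
Hypothesis rho_att : forall S, exists2 x, B x & bsum x S = rho S.

(** Replacing each weight by its position among the weights keeps their order and makes them natural
    numbers, so [Mconvex_greedy] applies. One base is thus tight on the whole chain of superlevel
    sets of [c]. *)
Lemma ex_greedy_base d (V : orderType d) (c : G -> V) :
  exists2 x, B x & forall S : {set G},
    (forall j l, j \in S -> (c j <= c l)%O -> l \in S) -> bsum x S = rho S.
Proof.
pose r j := #|[pred k | (c k < c j)%O]|.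
have [x Bx xmax] := ex_maximizer (wsum r) Bb B0.
exists x => // S Sup; apply/eqP; rewrite eqn_leq rho_ub //=.
have [y By <-] := rho_att S.
apply: (Mconvex_greedy MB Bx xmax) => // j l jS rjl; apply: (Sup j) => //.
rewrite leNgt; apply: contraTN rjl => clj; rewrite -ltnNge; apply: proper_card.
apply/properP; split; first by apply/fintype.subsetP => k; rewrite !inE => /lt_trans; apply.
by exists l; rewrite !inE ?ltxx.
Qed.

(** Every base maximizes the zero weight, so the greedy lemma applies to each of them on the full
    set. *)
Lemma base_sum x : B x -> bsum x [set: G] = rho [set: G]%SET.
Proof.
move=> Bx; apply/eqP; rewrite eqn_leq rho_ub //=; have [y By <-] := rho_att [set: G]%SET.
by apply: (@Mconvex_greedy B (fun=> 0%N) x).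
Qed.

(** For the weight that counts memberships in [S] and [S'], union and intersection are superlevel
    sets, so a single base is tight on both; sums over a fixed base are modular. *)
Lemma rho_submod (S S' : {set G}) : (rho (S :|: S')%SET + rho (S :&: S')%SET <= rho S + rho S')%N.
Proof.
have [x Bx xS] := ex_greedy_base (fun j => (j \in S) + (j \in S') : nat)%N.
have -> : rho (S :|: S')%SET = bsum x (S :|: S')%SET.
  by rewrite xS // => j l; rewrite !inE; do 4 case: (_ \in _).
have -> : rho (S :&: S')%SET = bsum x (S :&: S')%SET.
  by rewrite xS // => j l; rewrite !inE; do 4 case: (_ \in _).
by rewrite bsumUI leq_add ?rho_ub.
Qed.

Lemma rho_mono (S S' : {set G}) : S \subset S' -> (rho S <= rho S')%N.
Proof.
move=> SS'; have [x Bx <-] := rho_att S.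
by apply: leq_trans (bsumS _ SS') (rho_ub _ Bx).
Qed.

Local Notation P := (polymatroid (fun S => (rho S)%:Z)).

Lemma base_polymatroid : B `<=` P.
Proof. by move=> x Bx S; rewrite lez_nat rho_ub. Qed.

Lemma polymatroid_le x y : bundle_le x y -> P y -> P x.
Proof. by move=> xy Py S; apply: le_trans (Py S); rewrite lez_nat bsum_le. Qed.

Lemma polymatroid_box : P `<=` box b.
Proof.
move=> x Px j; have := Px [set j]%SET; rewrite bsum1 lez_nat => /leq_trans; apply.
by have [y By <-] := rho_att [set j]%SET; rewrite bsum1; apply: Bb.
Qed.

End RankFunction.
End Bundles.

(** * Demand sets and their minimal elements *)

Section Demand.
Variables (R : realType) (m n : nat) (s : {ffun 'I_m -> nat}).
Variables (v : 'I_n -> {ffun 'I_m -> nat} -> R) (q : 'I_n -> 'I_m -> R -> R).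
Variables (p : 'I_m -> R) (i : 'I_n).
Hypothesis hv : is_valuation s (v i).
Implicit Types (x y : {ffun 'I_m -> nat}) (S : {set 'I_m}).

Local Notation D := (demand s v q p i).
Local Notation B := (min_demand s v q p i).
Local Notation rho := (crho s v q p i).

Lemma demand_box : D `<=` box s.
Proof. by move=> x []. Qed.

Lemma demand_nonempty : D !=set0.
Proof.
have s0 : box s !=set0 by exists s => j.
have [x xs xmax] := ex_maximizer (utility v q p i) (@subset_refl _ (box s)) s0.
by exists x; split.
Qed.

(** The exchange preserves the sum of the two bundles, hence the total payment. Total utility
    therefore does not drop, and both new bundles must be optimal. *)
Lemma demand_exchange x x' j : D x -> D x' -> (x' j < x j)%N ->
  exists k : option 'I_m, [/\ if k is Some l then (x l < x' l)%N else True,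
    D (exchange x (Some j) k) & D (exchange x' k (Some j))].
Proof.
move=> [xs xmax] [xs' xmax'] xj.
have [k [xk vle]] := valuation_Mnat hv xs xs' xj.
set e := exchange x (Some j) k in vle *; set e' := exchange x' k (Some j) in vle *.
have eE l : (e l + e' l = x l + x' l)%N /\ (e l <= s l)%N /\ (e' l <= s l)%N.
  have := xs l; have := xs' l; rewrite ffunE [e' _]ffunE.
  case: k xk {vle e e'} => [k|] /= xk; rewrite ?chi_Some ?chi_None.
    case: (l =P j) => [->|_]; last by case: (l =P k) => [->|_]; lia.
    by case: (j =P k) => [kl|_]; [move: xk; rewrite -kl|]; lia.
  by case: (l =P j) => [->|_]; lia.
have es : box s e by move=> l; case: (eE l) => _ [].
have es' : box s e' by move=> l; case: (eE l) => _ [].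
have usum : utility v q p i x + utility v q p i x' <=
            utility v q p i e + utility v q p i e'.
  rewrite /utility addrACA [leRHS]addrACA lerD // -!opprD lerN2 -!big_split /=.
  apply: ler_sum => l _; rewrite -!mulrnDr.
  by case: (eE l) => ->.
have ue := xmax _ es; have ue' := xmax' _ es'; have xx' := xmax _ xs'.
have x'x := xmax' _ xs.
exists k; split => //; split => // y ys.
  by have := xmax _ ys; lra.
by have := xmax _ ys; lra.
Qed.

Lemma min_demand_below y : D y -> exists2 x, B x & bundle_le x y.
Proof.
move=> Dy; pose A := [set x | D x /\ bundle_le x y].
have [x [Dx xy] xmin] : exists2 x, A x & forall z, A z ->
    (bsum x [set: 'I_m]%SET <= bsum z [set: 'I_m]%SET)%N.
  have As : A `<=` box s by move=> x [/demand_box].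
  have A0 : A !=set0 by exists y; split => // j.
  have [x Ax xmax] := ex_maximizer (fun x => - (bsum x [set: 'I_m]%SET)%:Z) As A0.
  by exists x => // z /xmax; rewrite lerN2 lez_nat.
exists x => //; split => // z Dz zx; apply/eqP; apply: contraT => zneq.
have Az : A z by split => // j; apply: leq_trans (zx j) (xy j).
have [j zj] : exists j, (z j < x j)%N.
  apply/existsP; apply: contraR zneq => /existsPn H; apply/eqP/ffunP => j.
  by apply/eqP; rewrite eqn_leq (zx j) /= leqNgt H.
have := xmin _ Az; rewrite !bsumT leqNgt (bigD1 j) //= [ltnRHS](bigD1 j) //=.
by rewrite -addSn leq_add //; apply: leq_sum.
Qed.

(* The exchange moves [y] towards [x]; exchanging with [None] would contradict
   the minimality of [x], so the total of [y] never changes. *)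
Lemma min_demand_sum_le x y : B x -> D y -> (bsum x [set: 'I_m]%SET <= bsum y [set: 'I_m]%SET)%N.
Proof.
move=> [Dx xmin].
have [N] := ubnP (\sum_k (x k - y k))%N; elim: N y => // N IH y; rewrite ltnS => yN Dy.
have [j yj|xy] := pickP (fun j => y j < x j)%N; last first.
  by apply: bsum_le => j; rewrite leqNgt xy.
have [[l|] [xl De De']] := demand_exchange Dx Dy yj; last first.
  have ex : exchange x (Some j) None = x.
    apply: xmin => // l; rewrite ffunE chi_None chi_Some; lia.
  move/ffunP: ex => /(_ j); rewrite ffunE chi_None chi_Some eqxx addn0 subn1; case: (x j) yj => [|a] //= _ /eqP; rewrite ltn_eqF //.
have := IH _ (leq_trans (excess_exchange xl yj) yN) De'.
have := bsum_exchange j [set: 'I_m]%SET (leq_ltn_trans (leq0n _) xl).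
by rewrite !inE => /addIn ->.
Qed.

(** By [min_demand_sum_le] a demanded bundle is minimal as soon as its total is that of a minimal
    one, and an exchange between two goods keeps totals. *)
Lemma min_demand_Mconvex : Mconvex B.
Proof.
have inB x z : B x -> D z -> bsum z [set: 'I_m]%SET = bsum x [set: 'I_m]%SET -> B z.
  move=> Bx Dz zx; split => // w Dw wz; apply/ffunP => j; apply/eqP.
  rewrite eqn_leq wz /= leqNgt; apply/negP => wj.
  have := min_demand_sum_le Bx Dw; rewrite -zx !bsumT leqNgt.
  rewrite (bigD1 j) //= [ltnRHS](bigD1 j) //= -addSn leq_add //.
  by apply: leq_sum.
move=> x y j Bx By yj; have [Dx xmin] := Bx; have [Dy ymin] := By.
have [[l|] [xl De De']] := demand_exchange Dx Dy yj; last first.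
  (* A zero partner would yield a demanded bundle strictly below [x]. *)
  have ex : exchange x (Some j) None = x.
    apply: xmin => // l; rewrite ffunE chi_None chi_Some; lia.
  move/ffunP: ex => /(_ j); rewrite ffunE chi_None chi_Some eqxx addn0 subn1; case: (x j) yj => [|a] //= _ /eqP; rewrite ltn_eqF //.
exists l; split => //.
  apply: (inB x) => //.
  have := bsum_exchange l [set: 'I_m]%SET (leq_ltn_trans (leq0n _) yj).
  by rewrite !inE => /addIn ->.
apply: (inB y) => //.
have := bsum_exchange j [set: 'I_m]%SET (leq_ltn_trans (leq0n _) xl).
by rewrite !inE => /addIn ->.
Qed.

Lemma min_demand_box : B `<=` box s.
Proof. by move=> x [/demand_box]. Qed.

Lemma min_demand_nonempty : B !=set0.
Proof.
have [y Dy] := demand_nonempty; have [x Bx _] := min_demand_below Dy.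
by exists x.
Qed.

Lemma crho_max S : exists2 x, B x &
  bsum x S = rho S /\ forall y, B y -> (bsum y S <= rho S)%N.
Proof.
have [x Bx xmax] := ex_maximizer (fun x => bsum x S) min_demand_box min_demand_nonempty.
have -> : rho S = bsum x S.
  by apply: set_max_eq; [exists x | move=> _ [y By <-]; apply: xmax].
exists x => //; split => //.
Qed.

Lemma crho_att S : exists2 x, B x & bsum x S = rho S.
Proof. by have [x Bx []] := crho_max S; exists x. Qed.

Lemma crho_ub x S : B x -> (bsum x S <= rho S)%N.
Proof. by have [_ _ [_]] := crho_max S; apply. Qed.

(** The minimum over the demand set is attained at a minimal bundle. These all have the same total,
    so taking least on [S] means taking most on its complement. *)
Lemma mu_crho S : (mu s v q p i S + rho (~: S)%SET = rho [set: 'I_m]%SET)%N.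
Proof.
have [x Bx xS] := crho_att (~: S)%SET.
have sumE := base_sum min_demand_Mconvex crho_ub crho_att.
have -> : mu s v q p i S = bsum x S.
  apply: set_min_eq; first by exists x => //; case: Bx.
  move=> _ [y /min_demand_below[z Bz zy] <-]; apply: leq_trans (bsum_le S zy).
  rewrite -(leq_add2r (bsum x (~: S)%SET)) bsum_compl sumE // -(sumE z) //.
  by rewrite -(bsum_compl z S) leq_add2l xS crho_ub.
by rewrite -xS bsum_compl sumE.
Qed.

End Demand.

(** * Layer-cake decompositions *)

Section LayerCake.
Variables (d : Order.disp_t) (T : orderType d) (V : zmodType) (phi : T -> V).

Lemma mem_pairmap_pair (b : T) (ts : seq T) e : e \in pairmap pair b ts -> e.2 \in ts.
Proof.
elim: ts b => //= a ts IH b; rewrite inE => /orP[/eqP ->|/IH es].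
  by rewrite mem_head.
by rewrite in_cons es orbT.
Qed.

(** A telescoping sum: the steps between consecutive thresholds whose top is at most [t] are those
    from [b] up to [t]. *)
Lemma layer_cake (b : T) (ts : seq T) : path <%O b ts ->
  forall t, t \in b :: ts ->
  phi t - phi b =
  \sum_(e <- pairmap pair b ts) (phi e.2 - phi e.1) *+ (e.2 <= t)%O.
Proof.
elim: ts b => [|a ts IH] b /=.
  by move=> _ t; rewrite inE => /eqP ->; rewrite big_nil subrr.
move=> /andP[ba ats] t; rewrite inE big_cons /=.
have a_le t' : t' \in ts -> (a < t')%O.
  by move: ats; rewrite lt_path_sortedE => /andP[/allP h _] /h.
case: (eqVneq t b) => [-> _|_ /= tats].
  rewrite leNgt ba add0r subrr big1_seq // => e /andP[_ ein].
  have /a_le ae := mem_pairmap_pair ein.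
  by rewrite leNgt (lt_trans ba ae).
rewrite -(IH _ ats) //.
have -> : (a <= t)%O by move: tats; rewrite inE => /orP[/eqP ->|/a_le/ltW].
by rewrite mulr1n [RHS]addrC addrA subrK.
Qed.

(** The thresholds are the sorted values above [b]. The second clause allows the layer at a
    prescribed level to be singled out by putting that level into [vs]. *)
Lemma ex_layers (b : T) (vs : seq T) : (forall t, t \in vs -> (b <= t)%O) ->
  exists es : seq (T * T),
  [/\ forall e, e \in es -> [/\ (b <= e.1)%O, (e.1 < e.2)%O & e.2 \in vs],
      forall t, t \in vs -> (b < t)%O -> exists2 e, e \in es & e.2 = t &
      forall t, t \in vs -> phi t - phi b =
        \sum_(e <- es) (phi e.2 - phi e.1) *+ (e.2 <= t)%O].
Proof.
move=> bvs; pose ts := sort <=%O (undup [seq t <- vs | (b < t)%O]).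
have tsE t : (t \in ts) = (b < t)%O && (t \in vs).
  by rewrite mem_sort mem_undup mem_filter.
have bts : path <%O b ts.
  rewrite lt_path_sortedE; apply/andP; split.
    by apply/allP => t; rewrite tsE => /andP[].
  by rewrite sort_lt_sorted undup_uniq.
exists (pairmap pair b ts); split.
- move=> e ein; have evs : e.2 \in vs by move: (mem_pairmap_pair ein); rewrite tsE => /andP[].
  suff [? ?] : (b <= e.1)%O /\ (e.1 < e.2)%O by [].
  move: ein; elim: (ts) (b) bts => //= a s IH b' /andP[b'a sa].
  rewrite inE => /orP[/eqP -> //|/(IH _ sa)[ae ee]]; split => //.
  exact: le_trans (ltW b'a) ae.
- move=> t tvs bt; have : t \in ts by rewrite tsE bt.
  elim: (ts) (b) => //= a s IH b'; rewrite inE => /orP[/eqP ->|/(IH a)[e es et]].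
    by exists (b', a) => //; rewrite inE eqxx.
  by exists e => //; rewrite inE es orbT.
- move=> t tvs; apply: (layer_cake bts); rewrite inE tsE tvs andbT.
  by have := bvs _ tvs; rewrite le_eqVlt eq_sym.
Qed.

End LayerCake.

(** * Linear functionals on bundles *)

Section Dot.
Variables (G : finType) (V : zmodType).
Implicit Types (c : G -> V) (x : {ffun G -> nat}).

Definition dot c x : V := \sum_j c j *+ x j.

Lemma dot_layers I (es : seq I) (g : I -> V) (h : I -> pred G) c x :
  (forall j, c j = \sum_(e <- es) g e *+ h e j) ->
  dot c x = \sum_(e <- es) g e *+ bsum x [set j | h e j]%SET.
Proof.
move=> cE; rewrite /dot.
under eq_bigr => j _ do rewrite cE -sumrMnl.
rewrite exchange_big /=; apply: eq_bigr => e _.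
rewrite bsum_wsum /wsum -sumrMnr; apply: eq_bigr => j _.
by rewrite inE -mulrnA.
Qed.

Lemma dotB c c' x : dot (fun j => c j - c' j) x = dot c x - dot c' x.
Proof. by rewrite /dot -sumrB; apply: eq_bigr => j _; rewrite mulrnBl. Qed.

End Dot.

(** * The lexicographic order on R_gamma *)

Section GammaOrder.
Variable R : realType.
Implicit Types x y z : gammaR R.

Lemma gammaR_leE x y : (x <= y)%O = (x.1 < y.1) || (x.1 == y.1) && (x.2 <= y.2).
Proof.
have -> : (x <= y)%O = (x.1 <= y.1) && ((y.1 <= x.1) ==> (x.2 <= y.2)) by [].
by case: (ltrgtP x.1 y.1).
Qed.

Lemma gammaR_le1 x y : (x <= y)%O -> x.1 <= y.1.
Proof. by rewrite gammaR_leE => /orP[/ltW //|/andP[/eqP -> _]]. Qed.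

Lemma gammaR_lt1 x y : x.1 < y.1 -> (x < y)%O.
Proof. by move=> xy; rewrite ltNge gammaR_leE (gt_eqF xy) ltNge (ltW xy). Qed.

Lemma gammaR_leD2r z x y : (x + z <= y + z)%O = (x <= y)%O.
Proof.
by rewrite !gammaR_leE /= ltrD2r lerD2r (inj_eq (addIr _)).
Qed.

Lemma gammaR_leD x y x' y' : (x <= y)%O -> (x' <= y')%O -> (x + x' <= y + y')%O.
Proof.
move=> xy xy'; apply: (@le_trans _ _ (y + x')); first by rewrite gammaR_leD2r.
by rewrite ![y + _]addrC gammaR_leD2r.
Qed.

Lemma gammaR_leN x y : (- x <= - y)%O = (y <= x)%O.
Proof. by rewrite -(gammaR_leD2r (x + y)) addKr [x + y]addrC addKr. Qed.

Lemma gammaR_sub_ge0 x y : ((0 : gammaR R) <= y - x)%O = (x <= y)%O.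
Proof. by rewrite -(gammaR_leD2r x) add0r subrK. Qed.

Lemma gammaR_leMn n x y : (x <= y)%O -> (x *+ n <= y *+ n)%O.
Proof. by move=> xy; elim: n => // n IH; rewrite !mulrS gammaR_leD. Qed.

Lemma gammaR_leMn2 x n n' : ((0 : gammaR R) <= x)%O -> (n <= n')%N -> (x *+ n <= x *+ n')%O.
Proof.
move=> x0 nn'; rewrite -(subnK nn') mulrnDr -[X in (X <= _)%O]add0r.
by rewrite gammaR_leD2r -(mul0rn _ (n' - n)) gammaR_leMn.
Qed.

Lemma gammaR_ltMn2 x n n' : ((0 : gammaR R) < x)%O -> (x *+ n <= x *+ n')%O -> (n <= n')%N.
Proof.
move=> x0; apply: contraTT; rewrite -!ltnNge -ltNge => n'n.
have /le_lt_trans -> // : (x *+ n' <= x *+ n.-1)%O.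
  by apply: gammaR_leMn2; [exact: ltW|rewrite -ltnS (ltn_predK n'n)].
by rewrite -[in ltRHS](ltn_predK n'n) mulrS -[ltLHS]add0r lt_neqAle gammaR_leD2r
  (inj_eq (addIr _)) -lt_neqAle.
Qed.

Lemma gammaR_ler_sum I (r : seq I) (P : pred I) (F F' : I -> gammaR R) :
  (forall i, P i -> (F i <= F' i)%O) ->
  (\sum_(i <- r | P i) F i <= \sum_(i <- r | P i) F' i)%O.
Proof. by move=> FF'; apply: (@big_ind2 _ _ (fun a b : gammaR R => (a <= b)%O)) => // x y x' y'; apply: gammaR_leD. Qed.

Lemma gammaR_sum_tight (I : eqType) (r : seq I) (F F' : I -> gammaR R) :
  (forall i, i \in r -> (F i <= F' i)%O) ->
  (\sum_(i <- r) F' i <= \sum_(i <- r) F i)%O -> forall i, i \in r -> (F' i <= F i)%O.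
Proof.
move=> FF' le_sum i ir.
rewrite !(big_rem _ ir) /= in le_sum.
rewrite -(gammaR_leD2r (\sum_(j <- rem i r) F' j)); apply: le_trans le_sum _.
rewrite ![F i + _]addrC gammaR_leD2r big_seq [leRHS]big_seq.
by apply: gammaR_ler_sum => j /mem_rem /FF'.
Qed.

Lemma gammaR_sum1 I (r : seq I) (P : pred I) (F : I -> gammaR R) :
  (\sum_(i <- r | P i) F i).1 = \sum_(i <- r | P i) (F i).1.
Proof. by apply: (big_morph (fun x : gammaR R => x.1)). Qed.

Lemma gammaR_Mn1 x k : (x *+ k).1 = x.1 *+ k.
Proof. by elim: k => // k IH; rewrite !mulrS -IH. Qed.

End GammaOrder.

(** * The support function of a polymatroid *)

Section SupportFunction.
Variables (R : realType) (G : finType) (B : set {ffun G -> nat}).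
Variables (b : {ffun G -> nat}) (rho : {set G} -> nat).
Hypotheses (MB : Mconvex B) (Bb : B `<=` box b) (B0 : B !=set0).
Hypothesis rho_ub : forall x (S : {set G}), B x -> (bsum x S <= rho S)%N.
Hypothesis rho_att : forall S, exists2 x, B x & bsum x S = rho S.
Implicit Types (c : G -> gammaR R) (x y : {ffun G -> nat}) (A : set {ffun G -> nat}).

Local Notation P := (polymatroid (fun S => (rho S)%:Z)).

Definition suppfun A c : gammaR R := set_max (0 : gammaR R) [set dot c x | x in A].

Lemma suppfun_max A c : A `<=` box b -> A !=set0 ->
  exists2 x, A x & suppfun A c = dot c x /\ forall y, A y -> (dot c y <= dot c x)%O.
Proof.
move=> Ab A0; have [x Ax xmax] := ex_maximizer (dot c) Ab A0.
exists x => //; split => //.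
by apply: set_max_eq; [exists x | move=> _ [y Ay <-]; apply: xmax].
Qed.

Lemma suppfun_att A c : A `<=` box b -> A !=set0 ->
  exists2 x, A x & suppfun A c = dot c x.
Proof. by move=> Ab A0; have [x Ax []] := suppfun_max c Ab A0; exists x. Qed.

Lemma suppfun_ub A c y : A `<=` box b -> A y -> (dot c y <= suppfun A c)%O.
Proof.
move=> Ab Ay; have [x Ax [-> ]] := suppfun_max c Ab (ex_intro _ _ Ay).
exact.
Qed.

Definition gpos c : G -> gammaR R := fun j => Order.max (0 : gammaR R) (c j).

Lemma gpos_ge0 c j : ((0 : gammaR R) <= gpos c j)%O.
Proof. by rewrite le_max lexx. Qed.

Lemma dot_gpos_le c x : (dot c x <= dot (gpos c) x)%O.
Proof.
by apply: gammaR_ler_sum => j _; apply: gammaR_leMn; rewrite le_max lexx orbT.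
Qed.

(** [P] is closed downwards, so coordinates of nonpositive weight may be emptied. Hence maxima over
    [P] depend only on the positive part of the weight. *)
Lemma gpos_dot c y : P y -> exists2 x, P x & dot c x = dot (gpos c) y.
Proof.
move=> Py; exists [ffun j => if ((0 : gammaR R) < c j)%O then y j else 0%N].
  by apply: polymatroid_le Py => j; rewrite ffunE; case: ifP.
apply: eq_bigr => j _; rewrite ffunE /gpos.
by case: ltP => [//|_]; rewrite mul0rn mulr0n.
Qed.

Lemma P_box : P `<=` box b. Proof. exact: polymatroid_box Bb rho_att. Qed.

Lemma P_nonempty : P !=set0.
Proof. by have [x Bx] := B0; exists x; apply: base_polymatroid Bx. Qed.

Section Layers.
Variables (c : G -> gammaR R) (es : seq (gammaR R * gammaR R)).
Hypothesis es_lt : forall e, e \in es -> ((0 : gammaR R) <= e.1)%O /\ (e.1 < e.2)%O.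
Hypothesis es_sum :
  forall j, gpos c j = \sum_(e <- es) (e.2 - e.1) *+ (e.2 <= gpos c j)%O.

Local Notation layer e := [set j | (e.2 <= gpos c j)%O]%SET.

Lemma dot_gpos_layers x :
  dot (gpos c) x = \sum_(e <- es) (e.2 - e.1) *+ bsum x (layer e).
Proof. exact: (dot_layers (h := fun e j => (e.2 <= gpos c j)%O)). Qed.

(** The greedy formula: each layer contributes at most its rank, and the greedy base attains all
    these ranks at once because the layers are closed upwards for [c]. *)
Lemma suppfun_layers :
  suppfun P c = \sum_(e <- es) (e.2 - e.1) *+ rho (layer e).
Proof.
have [u Bu uS] := ex_greedy_base MB Bb B0 rho_ub rho_att c.
have uE : dot (gpos c) u = \sum_(e <- es) (e.2 - e.1) *+ rho (layer e).
  rewrite dot_gpos_layers; apply: eq_big_seq => e ein.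
  rewrite uS // => j l; rewrite !inE => ej jl; apply: le_trans ej _.
  by rewrite /gpos ge_max le_max lexx le_max jl orbT.
have [x Px xE] := gpos_dot c (base_polymatroid rho_ub Bu).
apply/le_anti/andP; split; last first.
  by rewrite -uE -xE; apply: suppfun_ub => //; apply: P_box.
have [y Py ->] := suppfun_att c P_box P_nonempty.
apply: le_trans (dot_gpos_le _ _) _.
rewrite dot_gpos_layers big_seq [leRHS]big_seq.
apply: gammaR_ler_sum => e /es_lt[_ e12]; apply: gammaR_leMn2.
  by rewrite gammaR_sub_ge0 ltW.
by have := Py (layer e); rewrite lez_nat.
Qed.

(** The bound behind [suppfun_layers] holds layer by layer with positive widths, so equality of the
    sums forces equality in each layer. *)
Lemma maximizer_tight_layer x : P x -> (suppfun P c <= dot c x)%O ->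
  forall e, e \in es -> bsum x (layer e) = rho (layer e).
Proof.
move=> Px xmax e ein; apply/eqP; rewrite eqn_leq.
have Pxl (e' : gammaR R * gammaR R) : (bsum x (layer e') <= rho (layer e'))%N.
  by have := Px (layer e'); rewrite lez_nat.
rewrite Pxl /=.
have e_gt0 : ((0 : gammaR R) < e.2 - e.1)%O.
  have [_] := es_lt ein; rewrite !lt_neqAle gammaR_sub_ge0 => /andP[ne ->].
  by rewrite eq_sym subr_eq0 eq_sym ne.
apply: (gammaR_ltMn2 e_gt0).
refine (gammaR_sum_tight (F := fun e : gammaR R * gammaR R => (e.2 - e.1) *+ bsum x (layer e))
  (F' := fun e : gammaR R * gammaR R => (e.2 - e.1) *+ rho (layer e)) _ _ ein).
  move=> e' /es_lt[_ e12]; apply: gammaR_leMn2 => //.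
  by rewrite gammaR_sub_ge0 ltW.
rewrite -suppfun_layers -dot_gpos_layers.
exact: le_trans xmax (dot_gpos_le _ _).
Qed.

End Layers.

Lemma maximizer_tight c x (t : gammaR R) : P x -> (suppfun P c <= dot c x)%O ->
  ((0 : gammaR R) < t)%O ->
  bsum x [set j | (t <= c j)%O]%SET = rho [set j | (t <= c j)%O]%SET.
Proof.
(* [t] is added to the values so that its superlevel set is one of the layers. *)
move=> Px xmax t0; pose vs := t :: codom (gpos c).
have vs0 t' : t' \in vs -> ((0 : gammaR R) <= t')%O.
  by rewrite inE => /orP[/eqP -> |/codomP[j ->]]; [exact: ltW|exact: gpos_ge0].
have [es [es_lt es_mem es_sum]] := @ex_layers _ (gammaR R) (gammaR R) id 0 vs vs0.
have {}es_lt e : e \in es -> ((0 : gammaR R) <= e.1)%O /\ (e.1 < e.2)%O.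
  by case/es_lt.
have [e ein et] := es_mem t (mem_head _ _) t0.
have -> : [set j | (t <= c j)%O]%SET = [set j | (e.2 <= gpos c j)%O]%SET.
  apply/setP => j; rewrite !inE et /gpos le_max [(t <= 0)%O]leNgt t0 /=.
  by [].
apply: maximizer_tight_layer ein => // j.
by rewrite -es_sum ?subr0 // inE codom_f orbT.
Qed.

(** With thresholds common to both weights, the layers of the minimum are intersections and those of
    the maximum are unions, so [rho_submod] applies in each layer. *)
Lemma suppfun_submod c c' :
  (suppfun P (fun j => Order.min (c j) (c' j)) +
   suppfun P (fun j => Order.max (c j) (c' j)) <= suppfun P c + suppfun P c')%O.
Proof.
pose vs := codom (gpos c) ++ codom (gpos c').
have vs0 t : t \in vs -> ((0 : gammaR R) <= t)%O.
  by rewrite mem_cat => /orP[] /codomP[j ->]; exact: gpos_ge0.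
have [es [es_lt _ es_sum]] := @ex_layers _ (gammaR R) (gammaR R) id 0 vs vs0.
have {}es_lt e : e \in es -> ((0 : gammaR R) <= e.1)%O /\ (e.1 < e.2)%O.
  by case/es_lt.
have {}es_sum t : t \in vs -> t = \sum_(e <- es) (e.2 - e.1) *+ (e.2 <= t)%O.
  by move=> /es_sum; rewrite subr0.
have vsc j : gpos c j \in vs by rewrite mem_cat codom_f.
have vsc' j : gpos c' j \in vs by rewrite mem_cat codom_f orbT.
have gmin j : gpos (fun j => Order.min (c j) (c' j)) j = Order.min (gpos c j) (gpos c' j).
  by rewrite /gpos max_minr.
have gmax j : gpos (fun j => Order.max (c j) (c' j)) j = Order.max (gpos c j) (gpos c' j).
  by rewrite /gpos maxACA maxxx.
rewrite !(suppfun_layers es_lt) => [|j|j|j|j].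
- rewrite -!big_split /= big_seq [leRHS]big_seq; apply: gammaR_ler_sum => e /es_lt[_ e12].
  rewrite -!mulrnDr; apply: gammaR_leMn2; first by rewrite gammaR_sub_ge0 ltW.
  rewrite addnC; apply: leq_trans (rho_submod MB Bb B0 rho_ub rho_att _ _).
  rewrite leq_eqVlt; apply/orP; left; apply/eqP; congr (rho _ + rho _)%N;
    by apply/setP => j; rewrite !inE ?gmax ?gmin (le_max, le_min).
- exact: es_sum.
- exact: es_sum.
- by rewrite gmax /Order.max; case: ifP => _; apply: es_sum.
- by rewrite gmin /Order.min; case: ifP => _; apply: es_sum.
Qed.

End SupportFunction.

(** * Restricting to [X] and splicing back *)

Section Glue.
Variables (m : nat) (X : {set 'I_m}).
Local Notation G := 'I_m.
Local Notation XG := {j : 'I_m | j \in X}.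

Definition splice T (f : {ffun G -> T}) (g : {ffun XG -> T}) : {ffun G -> T} :=
  [ffun j => if insub j is Some k then g k else f j].

Lemma splice_in T (f : {ffun G -> T}) (g : {ffun XG -> T}) k : splice f g (val k) = g k.
Proof. by rewrite ffunE valK. Qed.

Lemma splice_out T (f : {ffun G -> T}) (g : {ffun XG -> T}) j :
  j \notin X -> splice f g j = f j.
Proof. by move=> jX; rewrite ffunE insubF // (negPf jX). Qed.

Lemma splice_srestr T (f : {ffun G -> T}) : splice f (srestr X f) = f.
Proof.
apply/ffunP => j; have [jX|jX] := boolP (j \in X); last by rewrite splice_out.
by rewrite -[j](SubK XG jX) splice_in ffunE.
Qed.

Lemma big_split_sub V (idx : V) (op : Monoid.com_law idx) (F : G -> V) :
  \big[op/idx]_j F j =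
  op (\big[op/idx]_(k : XG) F (val k)) (\big[op/idx]_(j | j \notin X) F j).
Proof.
by rewrite [LHS](bigID (mem X)) /= big_sub.
Qed.

Lemma bbig_split_sub (x : {ffun G -> nat}) (S : {set XG}) :
  bsum (srestr X x) S = bsum x (val @: S).
Proof.
rewrite [in RHS]/bsum big_imset /=; last by move=> k l _ _; apply: val_inj.
by apply: eq_bigr => k _; rewrite ffunE.
Qed.

End Glue.

(** * Splitting the support function by contraction *)

Section Split.
Variables (R : realType) (m : nat).
Local Notation G := 'I_m.
Variables (B : set {ffun G -> nat}) (b : {ffun G -> nat}) (rho : {set G} -> nat) (X : {set G}).
Hypotheses (MB : Mconvex B) (Bb : B `<=` box b) (B0 : B !=set0).
Hypothesis rho_ub : forall x (S : {set G}), B x -> (bsum x S <= rho S)%N.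
Hypothesis rho_att : forall S, exists2 x, B x & bsum x S = rho S.
Local Notation XG := {j : G | j \in X}.
Implicit Types (x : {ffun G -> nat}) (y : {ffun XG -> nat}) (c : G -> gammaR R).

Local Notation P := (polymatroid (fun S => (rho S)%:Z)).
(** The rank of the contraction by the complement of [X]; for the rank [crho] of a buyer this is
    [trho]. *)
Definition contr_rank (S : {set XG}) : int :=
  (rho (val @: S :|: ~: X)%SET)%:Z - (rho (~: X)%SET)%:Z.
Local Notation PX := (polymatroid contr_rank).

Let submod := rho_submod MB Bb B0 rho_ub rho_att.

Lemma contraction_le k S :
  (k%:Z <= contr_rank S) = (k + rho (~: X)%SET <= rho (val @: S :|: ~: X)%SET)%N.
Proof. by rewrite lerBrDr -PoszD lez_nat. Qed.

(** By submodularity the marginal rank of a good over the complement of [X] is at most its own rank.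
    So the box of the virtual market cuts nothing off. *)
Lemma contraction_box : PX `<=` box (srestr X b).
Proof.
move=> y Py k; have := Py [set k]%SET.
rewrite bsum1 contraction_le imset_set1 ffunE => yk.
have [x Bx xk] := rho_att [set val k]%SET; have := Bb Bx (val k).
rewrite -(bsum1 x) xk; apply: leq_trans.
rewrite -(leq_add2r (rho (~: X)%SET)); apply: leq_trans yk _.
by apply: leq_trans (submod _ _); rewrite leq_addr.
Qed.

Lemma contraction_nonempty : PX !=set0.
Proof.
exists 0 => S; rewrite /bsum big1 => [|k _]; last by rewrite ffunE.
rewrite contraction_le; apply: (rho_mono rho_ub rho_att).
exact: finset.subsetUr.
Qed.

Lemma srestr_contraction x : P x -> bsum x (~: X)%SET = rho (~: X)%SET -> PX (srestr X x).
Proof.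
move=> Px xY S; rewrite bbig_split_sub contraction_le -xY.
have -> : (bsum x (val @: S) + bsum x (~: X) = bsum x (val @: S :|: ~: X))%N.
  rewrite -bsumUI; suff -> : (val @: S :&: ~: X = finset.set0)%SET.
    by rewrite /bsum big_set0 addn0.
  apply/setP => j; rewrite !inE; apply/negP => /andP[/imsetP[k _ ->]].
  by rewrite (valP k).
by have := Px (val @: S :|: ~: X)%SET; rewrite lez_nat.
Qed.

(** The bounds of [y] on the part of [S] in [X] and of [x] on the rest add up by submodularity
    applied to [S] and the complement of [X]. *)
Lemma splice_polymatroid x y : P x -> PX y -> P (splice x y).
Proof.
move=> Px Py S; pose SX := [set k : XG | val k \in S]%SET.
have -> : bsum (splice x y) S = (bsum y SX + bsum x (S :&: ~: X))%N.
  rewrite !bsum_wsum /wsum (big_split_sub X _ (fun j => (j \in S) * splice x y j)%N); congr (_ + _)%N.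
    by apply: eq_bigr => k _; rewrite splice_in inE.
  rewrite [RHS](big_split_sub X _ (fun j => (j \in S :&: ~: X) * x j)%N).
  rewrite [X in _ = (X + _)%N]big1 ?add0n => [|k _]; last by rewrite !inE (valP k) andbF.
  by apply: eq_bigr => j jX; rewrite splice_out // !inE jX andbT.
have := Py SX; have := Px (S :&: ~: X)%SET; rewrite contraction_le !lez_nat.
have -> : (val @: SX :|: ~: X = S :|: ~: X)%SET.
  apply/setP => j; rewrite !inE; case: (boolP (j \in X)) => jX; last by rewrite !orbT.
  rewrite /= !orbF; apply/imsetP/idP => [[k]|jS]; first by rewrite inE => ? ->.
  by exists (Sub j jX) => //; rewrite inE.
move=> xS yS; rewrite -(leq_add2r (rho (~: X)%SET)) addnAC.
by apply: leq_trans (leq_add yS xS) (submod _ _).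
Qed.

(** Zeroing the weight on [X] expresses the part of the maximum off [X] without a polymatroid on the
    complement. *)
Definition zero_on c : G -> gammaR R := fun j => if j \in X then 0 else c j.

(** The level [t] separates the complement of [X] from [X], so a maximizer is tight on the
    complement and restricts to the contraction. Conversely, maximizers of the two parts splice into
    a point of [P]. *)
Lemma suppfun_split c (t : gammaR R) : ((0 : gammaR R) < t)%O ->
  (forall j, (t <= c j)%O = (j \notin X)) ->
  suppfun P c = suppfun P (zero_on c) +
    suppfun PX (fun k => c (val k)).
Proof.
move=> t0 ct; have Pb : P `<=` box b := P_box Bb rho_att.
have P0 : P !=set0 := P_nonempty B0 rho_ub.
have dotE (x : {ffun G -> nat}) : dot c x = dot (zero_on c) x +
    dot (fun k : XG => c (val k)) (srestr X x).
  rewrite /dot (big_split_sub X _ (fun j => c j *+ x j)) /= addrC.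
  rewrite (big_split_sub X _ (fun j => zero_on c j *+ x j)) /=; congr (_ + _).
    rewrite [X in _ = X + _]big1 ?add0r => [|k _]; last by rewrite /zero_on (valP k) mul0rn.
    by apply: eq_bigr => j /negPf jX; rewrite /zero_on jX.
  by apply: eq_bigr => k _; rewrite ffunE.
apply/le_anti/andP; split.
  have [x Px xE] := suppfun_att c Pb P0.
  have xY : bsum x (~: X)%SET = rho (~: X)%SET.
    have -> : (~: X = [set j | (t <= c j)%O])%SET by apply/setP => j; rewrite !inE ct.
    by apply: (maximizer_tight MB Bb B0 rho_ub rho_att) => //; rewrite xE.
  rewrite xE dotE; apply: gammaR_leD; first exact: suppfun_ub Pb Px.
  exact: suppfun_ub contraction_box (srestr_contraction Px xY).
have [u Pu ->] := suppfun_att (zero_on c) Pb P0.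
have [y Py ->] := suppfun_att (fun k => c (val k)) contraction_box contraction_nonempty.
apply: le_trans (suppfun_ub c Pb (splice_polymatroid Pu Py)).
rewrite dotE; apply: gammaR_leD.
  apply: gammaR_ler_sum => j _; rewrite /zero_on; case: (boolP (j \in X)) => jX; first by rewrite !mul0rn.
  by rewrite splice_out.
by apply: gammaR_ler_sum => k _; rewrite ffunE splice_in.
Qed.

End Split.

(** * Scaling R_gamma by reals *)

Section GammaScale.
Variable R : realType.
Implicit Types (t : R) (x y : gammaR R).

Definition gscale t x : gammaR R := (t * x.1, t * x.2).

Lemma gscaleD t x y : gscale t (x + y) = gscale t x + gscale t y.
Proof. by congr pair; rewrite /= mulrDr. Qed.

Lemma gscale0 t : gscale t 0 = 0.
Proof. by congr pair; rewrite /= mulr0. Qed.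

Lemma gscaleN t x : gscale t (- x) = - gscale t x.
Proof. by congr pair; rewrite /= mulrN. Qed.

Lemma gscaleMn t x k : gscale t (x *+ k) = gscale t x *+ k.
Proof. by elim: k => [|k IH]; rewrite ?mulr0n ?gscale0 // !mulrS gscaleD IH. Qed.

Lemma gscale_sum t I (r : seq I) (P : pred I) (F : I -> gammaR R) :
  gscale t (\sum_(i <- r | P i) F i) = \sum_(i <- r | P i) gscale t (F i).
Proof. by apply: (big_morph (gscale t)); [exact: gscaleD|exact: gscale0]. Qed.

Lemma gscale_dot t (G : finType) (c : G -> gammaR R) (x : {ffun G -> nat}) :
  gscale t (dot c x) = dot (fun j => gscale t (c j)) x.
Proof. by rewrite gscale_sum; apply: eq_bigr => j _; rewrite gscaleMn. Qed.

Lemma gscale_le t x y : 0 < t -> (gscale t x <= gscale t y)%O = (x <= y)%O.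
Proof.
move=> t0; rewrite !gammaR_leE /= ltr_pM2l // ler_pM2l //.
by rewrite (inj_eq (mulfI (lt0r_neq0 t0))).
Qed.

Lemma gscale_split t x : gscale (1 - t) x + gscale t x = x.
Proof. by case: x => x1 x2; congr pair; rewrite /= -mulrDl subrK mul1r. Qed.

End GammaScale.

Lemma ex_pos_lt (R : realType) (I : finType) (f : I -> R) (A : pred I) :
  (forall i, A i -> 0 < f i) -> exists2 t, 0 < t & forall i, A i -> t < f i.
Proof.
move=> f0; suff [t t0 tf] : exists2 t, 0 < t & forall i, i \in enum A -> t < f i.
  by exists t => // i Ai; apply: tf; rewrite mem_enum.
have {f0} : forall i, i \in enum A -> 0 < f i by move=> i; rewrite mem_enum => /f0.
elim: (enum A) => [_|a r IH f0]; first by exists 1.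
have [|t t0 tf] := IH; first by move=> i ir; apply: f0; rewrite in_cons ir orbT.
have fa := f0 a (mem_head _ _).
exists (Num.min t (f a) / 2) => [|i]; first by rewrite divr_gt0 // lt_min t0.
have lt_half : Num.min t (f a) / 2 < Num.min t (f a).
  by rewrite ltr_pdivrMr // ltr_pMr ?lt_min ?t0 // (ltr_nat _ 1 2).
rewrite inE => /orP[/eqP ->|/tf].
  by apply: lt_le_trans lt_half _; rewrite ge_min lexx orbT.
by apply: lt_trans; apply: lt_le_trans lt_half _; rewrite ge_min lexx.
Qed.

(** * Over-demand and the leading prices of the solution of (D_2) *)

Section Auction.
Variables (R : realType) (m n : nat) (s : {ffun 'I_m -> nat}).
Variables (v : 'I_n -> {ffun 'I_m -> nat} -> R) (q : 'I_n -> 'I_m -> R -> R).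
Variable p : 'I_m -> R.
Hypothesis hv : forall i, is_valuation s (v i).
Implicit Types (i : 'I_n) (j : 'I_m) (S : {set 'I_m}) (z : {ffun 'I_m -> gammaR R}).

Local Notation rho := (crho s v q p).
Local Notation P i := (polymatroid (fun S => (rho i S)%:Z)).
Local Notation w := (weight q p).
Local Notation L := (D2_obj s v q p).
Local Notation sol := (D2_solutions s v q p).
Local Notation B := (min_demand s v q p).

Let MB i : Mconvex (B i) := min_demand_Mconvex (hv i).
Let Bb i : B i `<=` box s := @min_demand_box _ _ _ s v q p i.
Let B0 i : B i !=set0 := @min_demand_nonempty _ _ _ s v q p i.
Let ub i := @crho_ub _ _ _ s v q p i.
Let att i := @crho_att _ _ _ s v q p i.
Let Pb i : P i `<=` box s := P_box (@Bb i) (att i).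
Let P0 i : P i !=set0 := P_nonempty (B0 i) (@ub i).

Lemma D2_objE z : L z = \sum_i suppfun (P i) (fun j => w i j - z j) + dot z s.
Proof. by []. Qed.

Definition slack S : nat := (\sum_i rho i (~: S)%SET + bsum s S)%N.

Lemma overdemand_slack S :
  overdemand s v q p S = (\sum_i rho i [set: 'I_m]%SET)%:Z - (slack S)%:Z.
Proof.
have -> : (\sum_i rho i [set: 'I_m]%SET =
    \sum_i mu s v q p i S + \sum_i rho i (~: S)%SET)%N.
  by rewrite -big_split /=; apply: eq_bigr => i _; rewrite mu_crho.
rewrite /overdemand /slack; lia.
Qed.

Section Step.
Variable X : {set 'I_m}.
Hypothesis hX : is_unique_minimal (fun S S' : {set 'I_m} => S \subset S')
  (maximizers [set: {set 'I_m}] (overdemand s v q p)) X.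

Lemma slack_min S : (slack X <= slack S)%N.
Proof.
have [[_ Xmax] _] : minimals (fun S S' : {set 'I_m} => S \subset S')
  (maximizers [set: {set 'I_m}] (overdemand s v q p)) X by rewrite hX.
have := Xmax S Logic.I; rewrite !overdemand_slack; lia.
Qed.

(** Some inclusion-minimal minimizer of the slack lies inside [S], and by uniqueness it is [X]. *)
Lemma slack_sub S : (slack S <= slack X)%N -> X \subset S.
Proof.
move=> SX; have [S' /minsetP[S'X S'min] S'S] :
    {S' | minset [pred S | (slack S <= slack X)%N] S' & S' \subset S}.
  by apply: minset_exists.
suff -> : X = S' by [].
have : [set X] S'; last by move=> ->.
rewrite -hX; split.
  split => // S0 _; rewrite !overdemand_slack.
  have := slack_min S0; move: S'X; rewrite inE; lia.
move=> S0 [_ S0max] S0S'; apply: S'min => //; rewrite inE.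
have := S0max X Logic.I; rewrite !overdemand_slack; lia.
Qed.

Section Solution.
Variable z : {ffun 'I_m -> gammaR R}.
Hypothesis hz : is_unique_minimal (@gvec_le _ R) sol z.

Lemma z_sol : sol z.
Proof. by have [] : minimals (@gvec_le _ R) sol z by rewrite hz. Qed.

Lemma z_ge0 j : 0 <= (z j).1.
Proof. by have [z0 _] := z_sol; have := gammaR_le1 (z0 j); rewrite ffunE. Qed.

(** The form in which minimality is used: if some prices of [z] can be lowered at no cost, nothing
    was lowered. *)
Lemma z_minimal z' : (@gvec_nneg _ R) z' -> (L z' <= L z)%O -> gvec_le z' z -> z' = z.
Proof.
move=> z'0 z'L z'z; have [_ zmin] : minimals (@gvec_le _ R) sol z by rewrite hz.
apply: zmin => //; split => // z'' z''0; apply: le_trans z'L _.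
by have [_] := z_sol; apply.
Qed.

(** Submodularity bounds the objectives at meet and join by those at [z] and [z']. The join is no
    better than [z'], so the meet is no worse than [z] and equals it by minimality. *)
Lemma z_least z' : sol z' -> gvec_le z z'.
Proof.
move=> [z'0 z'min]; pose zm : {ffun 'I_m -> gammaR R} := [ffun j => Order.min (z j) (z' j)].
pose zM : {ffun 'I_m -> gammaR R} := [ffun j => Order.max (z j) (z' j)].
have [z0 zmin] := z_sol.
have zME : (L z' <= L zM)%O.
  apply: z'min => j; apply: le_trans (z0 j) _.
  by rewrite [zM j]ffunE le_max lexx.
suff : zm = z.
  by move=> zE j; rewrite -zE ffunE ge_min lexx orbT.
apply: z_minimal => [j|| j]; last by rewrite ffunE ge_min lexx.
  by rewrite [zm j]ffunE le_min z0 z'0.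
rewrite -(gammaR_leD2r (L z')); apply: le_trans (gammaR_leD (lexx _) zME) _.
rewrite !D2_objE addrACA [leRHS]addrACA; apply: gammaR_leD.
  rewrite -!big_split /=; apply: gammaR_ler_sum => i _.
  (* Passing from prices to margins swaps minimum and maximum. *)
  have subE (x a c : gammaR R) : x - Order.min a c = Order.max (x - a) (x - c) /\
      x - Order.max a c = Order.min (x - a) (x - c).
    have xE : (x - a < x - c)%O = (c < a)%O.
      by rewrite !ltNge ![x - _]addrC gammaR_leD2r gammaR_leN.
    rewrite /Order.min /Order.max xE; by case: (ltgtP a c) => // ->.
  have -> : (fun j => w i j - zm j) =
      (fun j => Order.max (w i j - z j) (w i j - z' j)).
    by apply/funext => j; rewrite ffunE (subE _ _ _).1.
  have -> : (fun j => w i j - zM j) =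
      (fun j => Order.min (w i j - z j) (w i j - z' j)).
    by apply/funext => j; rewrite ffunE (subE _ _ _).2.
  rewrite addrC.
  exact: (suppfun_submod (@MB i) (@Bb i) (B0 i) (@ub i) (att i)
    (fun j => w i j - z j) (fun j => w i j - z' j)).
rewrite /dot -!big_split /=; apply: gammaR_ler_sum => j _.
by rewrite -!mulrnDl !ffunE /Order.min /Order.max; case: ifP => _ //; rewrite addrC.
Qed.

(** Truncate the leading prices at 1. The leading term of the objective at [z] is at least an
    average of slacks of their superlevel sets, and by optimality at most [slack X], the least
    slack. So all these sets have least slack, including the one at level 1. *)
Lemma ge1_slack : (slack [set j | (1 <= (z j).1)%R]%SET <= slack X)%N.
Proof.
pose a j := (z j).1; pose e j := Num.min (a j) 1.
have e0 j : 0 <= e j by rewrite le_min z_ge0 ler01.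
have e1 j : e j <= 1 by rewrite ge_min lexx orbT.
(* Including 1 makes the widths sum to 1 and gives level 1 its own layer. *)
pose vs := 1 :: codom e.
have vs01 t : t \in vs -> 0 <= t <= 1.
  by rewrite inE => /orP[/eqP ->|/codomP[j ->]]; rewrite ?ler01 ?lexx // e0 e1.
have vs0 t : t \in vs -> 0 <= t by move/vs01 => /andP[].
have [es [es_lt es_mem es_sum]] := @ex_layers _ R R id 0 vs vs0.
pose d (l : R * R) : R := l.2 - l.1.
have d_gt0 l : l \in es -> 0 < d l by case/es_lt => _ l12 _; rewrite subr_gt0.
pose S (l : R * R) := [set j | l.2 <= e j]%SET.
have l_le1 l : l \in es -> 0 < l.2 <= 1.
  by case/es_lt => l1 l12 /vs01/andP[_ ->]; rewrite (le_lt_trans l1 l12).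
have sumd : \sum_(l <- es) d l = 1.
  have := es_sum 1 (mem_head _ _); rewrite subr0 => ->.
  rewrite big_seq [RHS]big_seq; apply: eq_bigr => l /l_le1/andP[_ ->].
  by rewrite mulr1n.
have eE j : e j = \sum_(l <- es) d l *+ (l.2 <= e j)%R.
  by rewrite -es_sum ?subr0 // inE codom_f orbT.
have low i : \sum_(l <- es) d l *+ rho i (~: S l)%SET <=
    (suppfun (P i) (fun j => w i j - z j)).1.
  (* A base greedy for low prices, emptied where the leading margin [1 - a j] is not positive; this
     leaves exactly the truncated margins [1 - e j]. *)
  have [x Bx xS] := ex_greedy_base (@MB i) (@Bb i) (B0 i) (@ub i) (att i) (fun j => - a j).
  pose x' : {ffun 'I_m -> nat} := [ffun j => if a j < 1 then x j else 0%N].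
  have Px' : P i x'.
    apply: polymatroid_le (base_polymatroid (@ub i) Bx) => j.
    by rewrite ffunE; case: ifP.
  have := gammaR_le1 (suppfun_ub (fun j => w i j - z j) (@Pb i) Px').
  apply: le_trans; rewrite gammaR_sum1.
  rewrite (eq_bigr (fun j => (1 - e j) *+ x j)) => [|j _]; last first.
    rewrite gammaR_Mn1 /= ffunE /e -/(a j); case: ltP => //.
    by rewrite subrr mul0rn mulr0n.
  rewrite -/(dot (fun j => 1 - e j) x).
  rewrite (dot_layers (es := es) (g := d) (h := fun l j => ~~ (l.2 <= e j))) => [|j].
    rewrite big_seq [leRHS]big_seq; apply: ler_sum => l les.
    rewrite xS.
      suff -> : [set j | ~~ (l.2 <= e j)]%SET = (~: S l)%SET by [].
      by apply/setP => j; rewrite !inE.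
    move=> j k; rewrite !inE -!ltNge /e !gt_min => jl; rewrite lerN2 => kj.
    have /andP[_ l1] := l_le1 _ les.
    move: jl; rewrite [1 < _]ltNge l1 !orbF => /(le_lt_trans kj) ->.
    by [].
  rewrite -sumd {1}eE -sumrB; apply: eq_bigr => l _.
  by case: (_ <= _); rewrite ?mulr1n ?mulr0n ?subrr ?subr0.
have lows : \sum_(l <- es) d l *+ bsum s (S l) <= (dot z s).1.
  rewrite -(dot_layers (c := e) (h := fun l j => l.2 <= e j)) // gammaR_sum1.
  by apply: ler_sum => j _; rewrite gammaR_Mn1 lerMn2r /e ge_min lexx orbT.
(* The competitor is the indicator of [X]. *)
pose zX : {ffun 'I_m -> gammaR R} := [ffun j => ((j \in X)%:R, 0)].
have zX0 : gvec_nneg zX.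
  move=> j; rewrite !ffunE gammaR_leE /= lexx andbT.
  by case: (j \in X); rewrite ?ltr01 ?eqxx ?orbT.
have ind (x : {ffun 'I_m -> nat}) (T : {set 'I_m}) :
    \sum_j (j \in T)%:R *+ x j = (bsum x T)%:R :> R.
  rewrite bsum_wsum /wsum natr_sum; apply: eq_bigr => j _.
  by rewrite natrM mulr_natr.
have up : (L zX).1 <= (slack X)%:R.
  rewrite D2_objE /slack natrD natr_sum /= gammaR_sum1; apply: lerD.
    apply: ler_sum => i _; have [x Px ->] := suppfun_att (fun j => w i j - zX j) (@Pb i) (P0 i).
    rewrite gammaR_sum1 (eq_bigr (fun j => (j \in ~: X)%SET%:R *+ x j)) => [|j _].
      by rewrite ind ler_nat; have := Px (~: X)%SET; rewrite lez_nat.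
    rewrite gammaR_Mn1 /= ffunE /= inE.
    by case: (j \in X); rewrite /= ?subrr ?subr0.
  rewrite gammaR_sum1 -ind; apply: ler_sum => j _.
  by rewrite gammaR_Mn1 ffunE.
have [_ zmin] := z_sol.
have : (L z).1 <= (slack X)%:R by apply: le_trans up; apply: gammaR_le1; apply: zmin.
rewrite D2_objE /= gammaR_sum1 => Lz.
have {Lz low lows} : \sum_(l <- es) d l *+ slack (S l) <= \sum_(l <- es) d l *+ slack X.
  rewrite sumrMnl sumd; apply: le_trans Lz; rewrite -[leLHS]addr0.
  under eq_bigr => l _ do rewrite /slack mulrnDr -sumrMnr.
  rewrite big_split /= exchange_big /= addr0; apply: lerD => //.
  by apply: ler_sum => i _.
have [l les l1] := es_mem 1 (mem_head _ _) ltr01.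
have -> : [set j | 1 <= (z j).1]%SET = S l.
  by apply/setP => j; rewrite !inE l1 /e le_min lexx andbT.
apply: contraTT; rewrite -ltnNge -ltNge => lt.
rewrite !(big_rem _ les) /=; apply: ltr_leD; first by rewrite ltr_pMn2l // d_gt0.
rewrite big_seq [leRHS]big_seq; apply: ler_sum => k /mem_rem kes.
by rewrite ler_wpMn2l ?slack_min // ltW // d_gt0.
Qed.

Lemma ge1_X j : j \in X -> 1 <= (z j).1.
Proof. by have /fintype.subsetP XU := slack_sub ge1_slack => /XU; rewrite inE. Qed.

Lemma z_le1 j0 : (z j0).1 <= 1.
Proof.
rewrite leNgt; apply/negP => j01.
(* The price [(1, beta)] dominates every weight. Lowering all leading prices above 1 to it leaves no
   buyer a positive margin there, so no maximum grows. *)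
pose beta : R := \sum_i \sum_j `|(w i j).2|.
have wbeta i j : (w i j <= (1, beta) :> gammaR R)%O.
  rewrite gammaR_leE /= eqxx ltxx /= (le_trans (ler_norm _)) //.
  rewrite /beta (bigD1 i) //= (bigD1 j) //= -addrA lerDl addr_ge0 ?sumr_ge0 //.
  by move=> *; rewrite sumr_ge0.
pose z' : {ffun 'I_m -> gammaR R} := [ffun j => if 1 < (z j).1 then (1, beta) else z j].
have z'z : gvec_le z' z.
  by move=> j; rewrite ffunE; case: ifP => // j1; apply/ltW/gammaR_lt1.
suff z'E : z' = z by move/ffunP: z'E => /(_ j0); rewrite ffunE j01 => zj; move: j01; rewrite -zj ltxx.
apply: z_minimal => //.
  have [z0 _] := z_sol; move=> j; rewrite [z' j]ffunE; case: ifP => // _.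
  by rewrite ffunE gammaR_leE /= ltr01.
rewrite !D2_objE; apply: gammaR_leD; last first.
  by apply: gammaR_ler_sum => j _; apply: gammaR_leMn; apply: z'z.
apply: gammaR_ler_sum => i _.
have [x Px ->] := suppfun_att (fun j => w i j - z' j) (@Pb i) (P0 i).
pose x' : {ffun 'I_m -> nat} := [ffun j => if 1 < (z j).1 then 0%N else x j].
have Px' : P i x' by apply: polymatroid_le Px => j; rewrite ffunE; case: ifP.
apply: le_trans (suppfun_ub _ (@Pb i) Px'); apply: gammaR_ler_sum => j _.
rewrite !ffunE; case: ifP => // _; rewrite mulr0n -(mul0rn _ (x j)).
by apply: gammaR_leMn; rewrite -(gammaR_leD2r (1, beta)) subrK add0r.
Qed.

Lemma z_X j : j \in X -> (z j).1 = 1.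
Proof. by move=> jX; apply/le_anti; rewrite z_le1 ge1_X. Qed.

(* Otherwise, by [ge1_slack], lowering the prices of the goods outside [X] with
   leading term 1 by a small real amount would not increase the objective: every
   maximizer for the lowered prices uses exactly the supply of these goods. *)
Lemma z_gap : exists2 t : R, 0 < t < 1 & forall j, j \notin X -> (z j).1 < 1 - t *+ 2.
Proof.
(* [t0] is below half the distance to 1 of every leading price below 1; the later cap at 1/2 keeps
   [t] below 1. *)
have [t0 t0_gt0 t0P] : exists2 t, 0 < t &
    forall j, (z j).1 < 1 -> t < (1 - (z j).1) / 2.
  by apply: (ex_pos_lt (A := fun j => (z j).1 < 1)) => j j1; rewrite divr_gt0 ?subr_gt0.
pose t := Num.min t0 (1 / 2).
have t_gt0 : 0 < t by rewrite lt_min t0_gt0; lra.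
have t_lt1 : t < 1 by rewrite gt_min; apply/orP; right; lra.
have tP j : (z j).1 < 1 -> (z j).1 < 1 - t *+ 2.
  move=> /t0P; have : t <= t0 by rewrite ge_min lexx.
  lra.
exists t => [|j jX]; first by rewrite t_gt0.
apply: (tP j); rewrite ltNge; apply/negP => j1.
pose U := [set j | 1 <= (z j).1]%SET; pose W := (U :\: X)%SET.
have XU : X \subset U := slack_sub ge1_slack.
have sU : slack U = slack X by apply/eqP; rewrite eqn_leq ge1_slack slack_min.
pose g : gammaR R := (t, 0).
pose z' : {ffun 'I_m -> gammaR R} := [ffun j => if j \in W then z j - g else z j].
suff zE : z' = z.
  have jW : j \in W by rewrite !inE jX.
  move/ffunP: zE => /(_ j); rewrite ffunE jW => /(congr1 (fun x : gammaR R => x.1)) /=.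
  lra.
have zU k : k \in U -> (z k).1 = 1.
  by rewrite inE => k1; apply/le_anti; rewrite z_le1.
have g0 : ((0 : gammaR R) <= g)%O by apply/ltW/gammaR_lt1.
have z'z : gvec_le z' z.
  move=> k; rewrite ffunE; case: ifP => // _.
  by rewrite -[leRHS]addr0 addrC [leRHS]addrC gammaR_leD2r -oppr0 gammaR_leN.
apply: z_minimal => //.
  have [z0 _] := z_sol; move=> k; rewrite [z' k]ffunE; case: ifP => // kW.
  rewrite ffunE; apply/ltW/gammaR_lt1 => /=.
  by rewrite zU ?subr_gt0 //; move: kW; rewrite inE => /andP[].
have zsE : dot z s = dot z' s + g *+ bsum s W.
  rewrite bsum_wsum /wsum -sumrMnr /dot -big_split /=; apply: eq_bigr => k _.
  rewrite ffunE; case: (k \in W); last by rewrite mul0n mulr0n addr0.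
  by rewrite mul1n -mulrnDl subrK.
(* [K i] is the amount that buyer [i] takes from [W] at the lowered prices. *)
have /choice[K KE] : forall i, exists k : nat, (k + rho i (~: U)%SET = rho i (~: X)%SET)%N /\
    (suppfun (P i) (fun j => w i j - z' j) <=
     suppfun (P i) (fun j => w i j - z j) + g *+ k)%O.
  move=> i; have [x Px xE] := suppfun_att (fun j => w i j - z' j) (@Pb i) (P0 i).
  (* The leading margins exceed [2t] off [U], equal [t] on [W] and vanish on [X]; the thresholds
     [2t] and [t/2] separate them. *)
  have tight (r : R) (T : {set 'I_m}) : 0 < r ->
      (forall k, k \in T -> r < (w i k - z' k).1) ->
      (forall k, k \notin T -> (w i k - z' k).1 < r) -> bsum x T = rho i T.
    move=> r0 Tin Tout.
    have -> : T = [set k | ((r, 0) <= w i k - z' k :> gammaR R)%O]%SET.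
      apply/setP => k; rewrite inE; apply/idP/idP => [kT|].
        by apply/ltW/gammaR_lt1; apply: Tin.
      by apply: contraTT => kT; rewrite -ltNge; apply/gammaR_lt1; apply: Tout.
    apply: (maximizer_tight (@MB i) (@Bb i) (B0 i) (@ub i) (att i)) => //.
      by rewrite xE.
    exact/gammaR_lt1.
  have cU k : k \notin U -> t *+ 2 < (w i k - z' k).1.
    move=> kU; rewrite ffunE finset.in_setD (negPf kU) andbF /=.
    by move: kU; rewrite inE -ltNge => /tP; lra.
  have cW k : k \in W -> (w i k - z' k).1 = t.
    move=> kW; rewrite ffunE kW /= zU; first by lra.
    by move: kW; rewrite inE => /andP[].
  have cX k : k \in X -> (w i k - z' k).1 = 0.
    move=> kX; rewrite ffunE finset.in_setD kX /= zU ?subrr //.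
    by move/fintype.subsetP: XU; apply.
  have UXW k : k \in U -> k \notin X -> k \in W by move=> kU kX; rewrite finset.in_setD kX.
  have tU : bsum x (~: U)%SET = rho i (~: U)%SET.
    apply: (tight (t *+ 2)) => [|k|k]; first by rewrite mulrn_wgt0.
      by rewrite inE => /cU.
    rewrite inE negbK => kU; case: (boolP (k \in X)) => kX.
      by rewrite cX // mulrn_wgt0.
    by rewrite cW ?UXW //; lra.
  have tX : bsum x (~: X)%SET = rho i (~: X)%SET.
    apply: (tight (t / 2)) => [|k|k]; first by rewrite divr_gt0.
      rewrite inE => kX; case: (boolP (k \in U)) => kU.
        by rewrite cW ?UXW //; lra.
      by have := cU _ kU; lra.
    by rewrite inE negbK => /cX ->; rewrite divr_gt0.
  exists (bsum x W); split.
    rewrite -tU -tX -bsumUI.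
    have -> : (W :&: ~: U = finset.set0)%SET.
      by apply/setP => k; rewrite !inE; case: (1 <= _); rewrite ?andbF.
    rewrite /(bsum _ finset.set0) big_set0 addn0; congr bsum.
    apply/setP => k; rewrite !inE; case: (boolP (k \in X)) => //= kX.
      by move/fintype.subsetP: XU => /(_ _ kX); rewrite inE => ->.
    by case: (1 <= _).
  rewrite xE; apply: (le_trans _ (gammaR_leD (suppfun_ub _ (@Pb i) Px) (lexx _))).
  rewrite le_eqVlt; apply/orP; left; apply/eqP.
  rewrite bsum_wsum /wsum -sumrMnr /dot -big_split /=; apply: eq_bigr => k _.
  rewrite ffunE; case: (k \in W); last by rewrite mul0n mulr0n addr0.
  by rewrite mul1n -mulrnDl opprB addrA addrAC.
(* Equal slack of [U] and [X] balances the rank difference against the supply of [W], so the rise of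
   the buyers' maxima is covered by the fall of the supply term. *)
have KW : (\sum_i K i = bsum s W)%N.
  have sK : (\sum_i rho i (~: X)%SET = \sum_i K i + \sum_i rho i (~: U)%SET)%N.
    by rewrite -big_split /=; apply: eq_bigr => i _; rewrite (KE i).1.
  have sW : bsum s U = (bsum s X + bsum s W)%N.
    rewrite -bsumUI.
    have -> : (X :&: W = finset.set0)%SET.
      by apply/setP => k; rewrite !inE; case: (k \in X).
    rewrite /(bsum _ finset.set0) big_set0 addn0; congr bsum.
    apply/setP => k; rewrite !inE; case: (boolP (k \in X)) => //= kX.
    by move/fintype.subsetP: XU => /(_ _ kX); rewrite inE => ->.
  move: sU; rewrite /slack sK sW [X in _ = (X + _)%N]addnC -addnA => /addnI.
  by rewrite addnC => /addIn.
rewrite !D2_objE zsE -KW -sumrMnr addrA [X in (_ <= X)%O]addrAC gammaR_leD2r.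
rewrite -big_split /=.
by apply: gammaR_ler_sum => i _; apply: (KE i).2.
Qed.

(** * The virtual market *)

Local Notation XG := {j : 'I_m | j \in X}.
Local Notation PX i := (polymatroid (@contr_rank _ (rho i) X)).
Implicit Types (y : {ffun XG -> gammaR R}).

Definition virtual_lagrangian y : gammaR R :=
  \sum_i suppfun (PX i) (fun k => w i (val k) - y k) + dot y (srestr X s).

Local Notation LX := virtual_lagrangian.

Let PXb i : PX i `<=` box (srestr X s) :=
  contraction_box (@MB i) (@Bb i) (B0 i) (@ub i) (att i).
Let PX0 i : PX i !=set0 := contraction_nonempty X (@ub i) (att i).

(** The contraction is nonempty and fits into the box, so the value -oo is never the maximum. *)
Lemma virtual_objE y : virtual_obj s v q p y = Some (LX y).
Proof.
have Some_sum (f : 'I_n -> gammaR R) :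
    \sum_i (Some (f i) : gammaRN R) = Some (\sum_i f i).
  by rewrite (big_morph (fun x => Some x : gammaRN R) (id1 := 0) (op1 := +%R)).
rewrite /virtual_obj (eq_bigr (fun i =>
  Some (suppfun (PX i) (fun k => w i (val k) - y k)) : gammaRN R)).
  by rewrite Some_sum.
move=> i _; apply: set_max_eq.
  have [x Px ->] := suppfun_att (fun k => w i (val k) - y k) (@PXb i) (PX0 i).
  exists x; first exact: PXb.
  by rewrite /vvaluation mem_set // dotB.
move=> _ [x xb <-]; rewrite /vvaluation; case: ifPn => [/set_mem Px|_] //.
have := suppfun_ub (fun k => w i (val k) - y k) (@PXb i) Px.
by rewrite dotB.
Qed.

(** Leading margins exceed [2t] off [X] and are at most [t] on [X], so the level [(2t, 0)] separates
    them for every buyer. Only the last summand depends on [y]. *)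
Lemma D2_splice (t : R) y : 0 < t -> (forall j, j \notin X -> (z j).1 < 1 - t *+ 2) ->
  (forall k, 1 - t <= (y k).1) ->
  L (splice z y) = \sum_i suppfun (P i) (zero_on X (fun j => w i j - z j)) +
    \sum_(j | j \notin X) z j *+ s j + LX y.
Proof.
move=> t0 zt yt; rewrite D2_objE /virtual_lagrangian addrACA -big_split /=.
congr (_ + _); last first.
  rewrite /dot (big_split_sub X _ (fun j => splice z y j *+ s j)) /= addrC; congr (_ + _).
    by apply: eq_bigr => j jX; rewrite splice_out.
  by apply: eq_bigr => k _; rewrite splice_in ffunE.
apply: eq_bigr => i _.
rewrite (@suppfun_split _ _ _ _ _ X (@MB i) (@Bb i) (B0 i) (@ub i) (att i) _ (t *+ 2, 0)).
- congr (_ + _).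
    congr suppfun; apply/funext => j; rewrite /zero_on.
    by case: (boolP (j \in X)) => // jX; rewrite splice_out.
  by congr suppfun; apply/funext => k; rewrite splice_in.
- by apply/gammaR_lt1; rewrite mulrn_wgt0.
move=> j; case: (boolP (j \in X)) => jX.
  apply/negP/negP; rewrite -ltNge; apply/gammaR_lt1 => /=.
  have := yt (Sub j jX); rewrite -(splice_in z) SubK; lra.
by apply/ltW/gammaR_lt1; rewrite splice_out //=; have := zt _ jX; lra.
Qed.

Definition mix (t : R) y y' : {ffun XG -> gammaR R} :=
  [ffun k => gscale (1 - t) (y k) + gscale t (y' k)].

(** Each buyer contributes a maximum of affine functions of the prices. *)
Lemma virtual_lagrangian_convex t y y' : 0 < t < 1 ->
  (LX (mix t y y') <= gscale (1 - t) (LX y) + gscale t (LX y'))%O.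
Proof.
move=> /andP[t0 t1]; rewrite /virtual_lagrangian !gscaleD addrACA.
have t1' : 0 < 1 - t by rewrite subr_gt0.
apply: gammaR_leD.
  rewrite !gscale_sum -big_split /=; apply: gammaR_ler_sum => i _.
  have [x Px ->] := suppfun_att (fun k => w i (val k) - mix t y y' k) (@PXb i) (PX0 i).
  have lex y0 : (dot (fun k => w i (val k) - y0 k) x <=
      suppfun (PX i) (fun k => w i (val k) - y0 k))%O := suppfun_ub _ (@PXb i) Px.
  have := lex y; rewrite -(gscale_le _ _ t1') => ley.
  have := lex y'; rewrite -(gscale_le _ _ t0) => ley'.
  apply: le_trans (gammaR_leD ley ley'); rewrite le_eqVlt; apply/orP; left; apply/eqP.
  rewrite !gscale_dot /dot -big_split /=; apply: eq_bigr => k _.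
  rewrite -mulrnDl; congr (_ *+ _).
  rewrite ffunE -{1}(gscale_split t (w i (val k))) !gscaleD !gscaleN opprD.
  by rewrite addrACA.
rewrite !gscale_dot /dot -big_split /= le_eqVlt; apply/orP; left; apply/eqP.
by apply: eq_bigr => k _; rewrite -mulrnDl [mix _ _ _ _]ffunE.
Qed.

(** The mixture [yt] has leading prices at least [1 - t], as those of [z] are 1 on [X] and [y] is
    nonnegative; so [D2_splice] covers both [z] and [yt]. Optimality of [z] compares it with [yt],
    and convexity passes the comparison on to [y]. *)
Lemma virtual_solution_ge y : (@gvec_nneg _ R) y ->
  (LX (srestr X z) <= LX y)%O /\
  ((LX y <= LX (srestr X z))%O -> gvec_le (srestr X z) y).
Proof.
move=> y0; have [t /andP[t0 t1] zt] := z_gap; pose yt := mix t (srestr X z) y.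
have yt0 k : 1 - t <= (yt k).1.
  rewrite /yt !ffunE /= z_X ?(valP k) // mulr1 lerDl mulr_ge0 ?(ltW t0) //.
  by have := gammaR_le1 (y0 k); rewrite ffunE.
have zt0 k : 1 - t <= (srestr X z k).1.
  by rewrite ffunE z_X ?(valP k) // gerBl ltW.
have := D2_splice t0 zt zt0; rewrite splice_srestr => LzE.
have LytE := D2_splice t0 zt yt0.
have [z0 zmin] := z_sol.
have splice0 : gvec_nneg (splice z yt).
  move=> j; case: (boolP (j \in X)) => jX; last by rewrite splice_out.
  rewrite -[j](SubK XG jX) splice_in [leLHS]ffunE; apply/ltW/gammaR_lt1.
  by apply: lt_le_trans (yt0 _); rewrite subr_gt0.
have t01 : 0 < t < 1 by rewrite t0.
have conv := virtual_lagrangian_convex (srestr X z) y t01.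
have LXyt : (LX (srestr X z) <= LX yt)%O.
  by have := zmin _ splice0; rewrite LzE LytE addrC [leRHS]addrC gammaR_leD2r.
split => [|yz].
  have := le_trans LXyt conv; rewrite -[leLHS](gscale_split t).
  by rewrite addrC [leRHS]addrC gammaR_leD2r gscale_le.
(* If [y] is no worse, convexity makes the spliced mixture optimal in (D_2), so it lies above [z];
   cancelling the share of [z] gives the claim for [y]. *)
have ytsol : sol (splice z yt).
  split => // z' z'0; apply: le_trans (zmin _ z'0); rewrite LzE LytE.
  rewrite addrC [leRHS]addrC gammaR_leD2r; apply: le_trans conv _.
  by rewrite -[leRHS](gscale_split t) addrC [leRHS]addrC gammaR_leD2r gscale_le.
move=> k; have := z_least ytsol (val k); rewrite splice_in [yt k]ffunE.
rewrite [srestr X z k]ffunE -{1}[z (val k)](gscale_split t).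
by rewrite addrC [leRHS]addrC gammaR_leD2r gscale_le.
Qed.

End Solution.
End Step.
End Auction.

(** * Conclusion for the virtual market *)

Theorem lemma4p10 (R : realType) (m n : nat) (hn : (2 <= n)%N)
    (s : {ffun 'I_m -> nat})
    (v : 'I_n -> {ffun 'I_m -> nat} -> R) (q : 'I_n -> 'I_m -> R -> R)
    (hv : forall i, is_valuation s (v i))
    (hq : forall i j, is_payment (q i j))
    (hqv : forall i, payment_reaches s (v i) (q i))
    (p : 'I_m -> R) (hp : forall j, 0 <= p j)
    (Xstar : {set 'I_m})
    (hX : is_unique_minimal (fun X Y : {set 'I_m} => X \subset Y)
            (maximizers [set: {set 'I_m}] (overdemand s v q p)) Xstar)
    (zstar : {ffun 'I_m -> gammaR R})
    (hz : is_unique_minimal (@gvec_le _ R) (D2_solutions s v q p) zstar) :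
  is_unique_minimal (@gvec_le _ R) (virtual_solutions s v q p (X := Xstar))
    (srestr Xstar zstar).
Proof.
have zX_sol : virtual_solutions s v q p (srestr Xstar zstar).
  split => [k|y y0].
    by have [z0 _] := z_sol hz; rewrite [srestr _ _ _]ffunE; have := z0 (val k); rewrite !ffunE.
  rewrite !(virtual_objE _ _ hv).
  exact (virtual_solution_ge hv hX hz y0).1.
have zX_least y : virtual_solutions s v q p y -> gvec_le (srestr Xstar zstar) y.
  move=> [y0 ymin]; apply: (virtual_solution_ge hv hX hz y0).2.
  by have := ymin _ zX_sol.1; rewrite !virtual_objE.
(* A least element of the solution set is its only minimal element. *)
apply/seteqP; split => [y [ysol ymin]|_ ->] /=.
  by apply/esym/ymin => //; apply: zX_least.
split => // y ysol yz; apply/ffunP => k; apply/le_anti.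
by rewrite yz zX_least.
Qed.
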